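(* Let $k$ be a field and $r\ge 1$ an integer. Let $\mathcal O=\mathcal O_{k,r}$ and $\omega=\omega_{k,r}=\mathcal M_{k,r,K_r}$ where $K_r=(r-2,r-2)$. Then $H^1(\omega)\cong k$, and strong duality with respect to $\omega$ (over $\mathcal O$) holds for 1. the skyscraper sheaf $\mathrm{Sky}(B_1,\,k[y_1]/y_1k[y_1])$, and 2. the skyscraper sheaf $\mathrm{Sky}(B_2,\,k[y_2]/y_2k[y_2])$.
   Context: **Category, sheaves of rings and modules.** Let $\mathcal C_{2V}$ be the category with objects $A_1,A_2,B_1,B_2,B_3$ whose non-identity morphisms are exactly one morphism for each of $A_1\to B_1$, $A_2\to B_2$, $A_1\to B_3$, $A_2\to B_3$. A sheaf of rings ($k$-algebras, abelian groups, ...) on $\mathcal C_{2V}$ is a contravariant functor to that category; the map $\mathcal F(B_j)\to\mathcal F(A_i)$ is denoted $\mathcal F(A_i,B_j)$. For a sheaf of rings $\mathcal O$, a sheaf of $\mathcal O$-modules $\mathcal M$ is a sheaf of abelian groups with an $\mathcal O(P)$-module structure on $\mathcal M(P)$ for each object $P$ such that $\mathcal M(A,B)(am)=(\mathcal O(A,B)a)(\mathcal M(A,B)m)$. Morphisms are natural transformations that are $\mathcal O(P)$-linear at each $P$. The category of $\mathcal O$-modules is abelian with enough projectives and injectives; $\mathrm{Ext}^i_{\mathcal O}$ are the derived functors of $\mathrm{Hom}_{\mathcal O}$, and $H^i(\mathcal F)=\mathrm{Ext}^i_{\mathcal O}(\mathcal O,\mathcal F)$. (Equivalently for $\mathcal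 O_{k,r}$: $H^0,H^1$ are the kernel and cokernel of $\bigoplus_{j=1}^3\mathcal F(B_j)\to\mathcal F(A_1)\oplus\mathcal F(A_2)$, $(m_1,m_2,m_3)\mapsto(\mathcal F(A_1,B_1)m_1-\mathcal F(A_1,B_3)m_3,\ \mathcal F(A_2,B_2)m_2-\mathcal F(A_2,B_3)m_3)$, and $H^i=0$ for $i\ge2$.) **$\mathcal O_{k,r}$.** The sheaf of $k$-algebras with $\mathcal O(B_1)=k[y_1]$, $\mathcal O(B_2)=k[y_2]$, $\mathcal O(B_3)=k[v,1/v]$, $\mathcal O(A_i)=k[x_i,1/x_i]$ ($i=1,2$), and restriction maps the $k$-algebra morphisms with $y_1\mapsto 1/x_1$, $y_2\mapsto 1/x_2$, $v\mapsto x_1^r$ (to $A_1$), $v\mapsto x_2^{-r}$ (to $A_2$). **$\mathcal M_{k,r,\mathbf d}$** for $\mathbf d=(d_1,d_2)\in\mathbb Z^2$. The sheaf of $\mathcal O_{k,r}$-modules with $\mathcal M(P)=\mathcal O_{k,r}(P)$ for $P\ne B_3$, $\mathcal M(B_3)=k[v,1/v]^{\oplus r}$ with standard basis $e_1,\dots,e_r$, and restriction maps determined by $\mathcal M(A_i,B_i)(1)=x_i^{d_i}$ and $\mathcal M(A_i,B_3)(e_j)=x_i^{j-1}$ for $i=1,2$, $1\le j\le r$. **Skyscrapers.** For $i=1,2$ and a $k[y_i]$-module $N$, $\mathrm{Sky}(B_i,N)$ is the $\mathcal O_{k,r}$-module with value $N$ at $B_i$ and $0$ at all other objects. **Strong duality.**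 Let $\omega$ be an $\mathcal O$-module with an isomorphism $\phi:H^1(\omega)\to k$. For an $\mathcal O$-module $\mathcal F$ the Yoneda product gives pairings $H^i(\mathcal F)\times\mathrm{Ext}^{1-i}_{\mathcal O}(\mathcal F,\omega)\to H^1(\omega)\xrightarrow{\phi}k$. Strong duality holds for $\mathcal F$ with respect to $\omega$ if this is a perfect pairing for both $i=0$ and $i=1$, and $H^i(\mathcal F)=0$ and $\mathrm{Ext}^i_{\mathcal O}(\mathcal F,\omega)=0$ for all $i\ge 2$. (This does not depend on the choice of isomorphism $\phi$.) *)

(* Defs.v *)
From HB Require Import structures.
From mathcomp Require Import all_boot all_order all_algebra.
From mathcomp Require Import boolp.
From Stdlib Require Eqdep_dec.
From mathcomp.multinomials Require Import freeg.

Set Implicit Arguments.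
Unset Strict Implicit.
Unset Printing Implicit Defensive.

Import GRing.Theory.
Local Open Scope ring_scope.
#[local] Obligation Tactic := idtac.

Section SubQuot.
Variables (R : pzRingType).

(* The quotient module V / S. *)
Section Quot.
Variables (V : lmodType R) (S : submodClosed V).
Local Open Scope quotient_scope.

Definition qpred : {pred V} := [in S].
Lemma qpred_zmod : zmod_closed qpred.
Proof.
split=> [|x y xS yS]; first exact: rpred0.
by apply: rpredD => //; rewrite -scaleN1r; apply: rpredZ.
Qed.
HB.instance Definition _ := GRing.isZmodClosed.Build V qpred qpred_zmod.

Definition qmod : Type := Quotient.quot qpred.
HB.instance Definition _ := GRing.Zmodule.on qmod.

Definition qclass (x : V) : qmod := \pi_(Quotient.quot qpred) x.

Lemma qclassP x y : (qclass x = qclass y) <-> (x - y \in S).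
Proof.
by split=> [/eqP|h]; [|apply/eqP]; rewrite -Quotient.idealrBE.
Qed.

Lemma qclass_surj (X : qmod) : exists x, X = qclass x.
Proof. by exists (repr (X : Quotient.quot qpred)); rewrite /qclass reprK. Qed.

Lemma qclass_zmod : zmod_morphism qclass.
Proof. by move=> x y; rewrite /qclass raddfB. Qed.
HB.instance Definition _ := GRing.isZmodMorphism.Build V qmod qclass qclass_zmod.

Definition qscale (a : R) (X : qmod) : qmod :=
  qclass (a *: repr (X : Quotient.quot qpred)).

Lemma qscaleE a x : qscale a (qclass x) = qclass (a *: x).
Proof.
apply/qclassP; rewrite -scalerBr rpredZ //.
by apply/qclassP; rewrite /qclass reprK.
Qed.

Lemma qscaleA a b X : qscale a (qscale b X) = qscale (a * b) X.
Proof. by have [x ->] := qclass_surj X; rewrite !qscaleE scalerA. Qed.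
Lemma qscale1 : left_id 1 qscale.
Proof. by move=> X; have [x ->] := qclass_surj X; rewrite qscaleE scale1r. Qed.
Lemma qscaleDr : right_distributive qscale +%R.
Proof.
move=> a X Y; have [x ->] := qclass_surj X; have [y ->] := qclass_surj Y.
by rewrite -raddfD !qscaleE scalerDr raddfD.
Qed.
Lemma qscaleDl X : {morph qscale^~ X : a b / a + b}.
Proof.
move=> a b; have [x ->] := qclass_surj X.
by rewrite !qscaleE scalerDl raddfD.
Qed.
HB.instance Definition _ := GRing.Zmodule_isLmodule.Build R qmod
  qscaleA qscale1 qscaleDr qscaleDl.
Lemma qclass_scalable : scalable qclass.
Proof. by move=> a x; rewrite [RHS]qscaleE. Qed.
HB.instance Definition _ :=
  GRing.isScalable.Build R V qmod *:%R qclass qclass_scalable.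
End Quot.

Section Ker.
Variables (U V : lmodType R) (f : {linear U -> V}).

Definition in_ker : {pred U} := fun x => f x == 0.
Lemma in_kerE x : (x \in in_ker) = (f x == 0). Proof. by []. Qed.
Lemma in_ker_submod : subsemimod_closed in_ker.
Proof.
split; first split=> [|x y]; rewrite ?in_kerE ?linear0 //.
  by move=> /eqP fx /eqP fy; rewrite linearD fx fy addr0.
by move=> a x; rewrite !in_kerE linearZ /= => /eqP->; rewrite scaler0.
Qed.
HB.instance Definition _ := GRing.isSubmodClosed.Build R U in_ker in_ker_submod.

Record kernel := Kernel { ker_val :> U; kerP : ker_val \in in_ker }.
HB.instance Definition _ := [isSub for ker_val].
HB.instance Definition _ := [Choice of kernel by <:].
HB.instance Definition _ := [SubChoice_isSubLmodule of kernel by <:].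
End Ker.
End SubQuot.

(* The submodule a R of R, for R commutative. *)
Section Principal.
Variables (R : comNzRingType) (a : R).
Definition principal : {pred R^o} := fun x => `[< exists b, x = a * b >].
Lemma principal_submod : subsemimod_closed principal.
Proof.
split; first split=> [|x y /asboolP[b ->] /asboolP[c ->]].
- by apply/asboolP; exists 0; rewrite mulr0.
- by apply/asboolP; exists (b + c); rewrite mulrDr.
by move=> c x /asboolP[b ->]; apply/asboolP; exists (c * b); rewrite mulrCA.
Qed.
HB.instance Definition _ :=
  GRing.isSubmodClosed.Build R R^o principal principal_submod.
End Principal.

Local Notation "x %:F" := (@FracField.tofrac _ x).

(* The ring k[X, 1/X], realised as the subring of k(X) of the fractions f such
   that f X^n is a polynomial for some n. *)
Section Laurent.
Variable k : fieldType.

Definition is_laurent : {pred {fraction {poly k}}} :=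
  fun f => `[< exists n (p : {poly k}), f * ('X : {poly k})%:F ^+ n = p%:F >].

Lemma is_laurent_subring : subring_closed is_laurent.
Proof.
split.
- by apply/asboolP; exists 0%N, 1; rewrite mulr1 tofrac1.
- move=> f g /asboolP[n [p fE]] /asboolP[m [q gE]].
  apply/asboolP; exists (n + m)%N, (p * 'X^m - q * 'X^n).
  rewrite tofracB !tofracM !tofracXn -fE -gE mulrBl.
  by rewrite exprD mulrA [_ ^+ n * _]mulrC mulrA.
- move=> f g /asboolP[n [p fE]] /asboolP[m [q gE]].
  apply/asboolP; exists (n + m)%N, (p * q).
  by rewrite tofracM -fE -gE exprD mulrACA.
Qed.
HB.instance Definition _ :=
  GRing.isSubringClosed.Build {fraction {poly k}} is_laurent is_laurent_subring.

Record laurent := Laurent { laurent_val :> {fraction {poly k}};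
                            laurentP : laurent_val \in is_laurent }.
HB.instance Definition _ := [isSub for laurent_val].
HB.instance Definition _ := [Choice of laurent by <:].
HB.instance Definition _ := [SubChoice_isSubComNzRing of laurent by <:].

Lemma polyC_laurent (c : k) : (c%:P)%:F \in is_laurent.
Proof. by apply/asboolP; exists 0%N, c%:P; rewrite mulr1. Qed.

Definition laurentC (c : k) : laurent := Laurent (polyC_laurent c).

Definition laurent_scale (c : k) (f : laurent) : laurent := laurentC c * f.

Lemma laurent_scaleA a b f :
  laurent_scale a (laurent_scale b f) = laurent_scale (a * b) f.
Proof. by apply: val_inj; rewrite /= mulrA -tofracM -polyCM. Qed.
Lemma laurent_scale1 : left_id 1 laurent_scale.
Proof. by move=> f; apply: val_inj; rewrite /= tofrac1 mul1r. Qed.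
Lemma laurent_scaleDr : right_distributive laurent_scale +%R.
Proof. by move=> c f g; rewrite /laurent_scale mulrDr. Qed.
Lemma laurent_scaleDl f : {morph laurent_scale^~ f : a b / a + b}.
Proof.
by move=> a b; apply: val_inj; rewrite /= polyCD tofracD mulrDl.
Qed.
HB.instance Definition _ := GRing.Zmodule_isLmodule.Build k laurent
  laurent_scaleA laurent_scale1 laurent_scaleDr laurent_scaleDl.

Lemma laurent_scaleAl (c : k) (f g : laurent) : c *: (f * g) = (c *: f) * g.
Proof. by rewrite /GRing.scale /= /laurent_scale mulrA. Qed.
HB.instance Definition _ :=
  GRing.Lmodule_isLalgebra.Build k laurent laurent_scaleAl.
HB.instance Definition _ := GRing.Lalgebra_isComAlgebra.Build k laurent.

Lemma tofracX_neq0 : ('X : {poly k})%:F != 0.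
Proof. by rewrite tofrac_eq0 polyX_eq0. Qed.

Lemma polyX_laurent (n : int) : ('X : {poly k})%:F ^ n \in is_laurent.
Proof.
apply/asboolP; case: n => n.
  by exists 0%N, 'X^n; rewrite mulr1 tofracXn.
exists n.+1, 1; rewrite tofrac1; apply: mulVf; apply: expf_neq0.
exact: tofracX_neq0.
Qed.

Definition lX (n : int) : laurent := Laurent (polyX_laurent n).

Lemma lXD m n : lX (m + n) = lX m * lX n.
Proof. by apply: val_inj; exact: expfzDr tofracX_neq0. Qed.
Lemma lX0 : lX 0 = 1. Proof. exact: val_inj. Qed.
Lemma lXV n : lX n * lX (- n) = 1. Proof. by rewrite -lXD subrr lX0. Qed.

Lemma lXNV n : lX (- n) * lX n = 1. Proof. by rewrite mulrC lXV. Qed.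

Section PolyEval.
Variables (A : comAlgType k) (u : A).

(* [horner_alg] only carries a scaling structure through [in_alg]; this copy
   is a morphism of k-algebras for the scaling [*:%R]. *)
Definition poly_eval : {poly k} -> A := horner_alg u.
HB.instance Definition _ := GRing.RMorphism.on poly_eval.
Lemma poly_eval_scalable : scalable poly_eval.
Proof.
move=> c p; rewrite -mul_polyC rmorphM /= -mulr_algl; congr (_ * _).
exact: horner_algC.
Qed.
HB.instance Definition _ :=
  GRing.isScalable.Build k {poly k} A *:%R poly_eval poly_eval_scalable.
End PolyEval.

(* The morphism of k-algebras k[X, 1/X] -> A sending X to the unit u, whose
   inverse is w; see [laurent_evalE] and [laurent_eval_lX]. *)
Section Eval.
Variables (A : comAlgType k) (u w : A) (uw : u * w = 1).

Definition laurent_eval (_ : u * w = 1) (f : laurent) : A :=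
  let: exist n fn := cid (asboolW (laurentP f)) in
  let: exist p _ := cid fn in
  horner_alg u p * w ^+ n.

Local Notation ev := (laurent_eval uw).

Lemma laurent_evalE (f : laurent) n (p : {poly k}) :
  laurent_val f * ('X : {poly k})%:F ^+ n = p%:F -> ev f = horner_alg u p * w ^+ n.
Proof.
rewrite /laurent_eval; case: cid => m fm; case: cid => q fq fp.
have e : p * 'X^m = q * 'X^n.
  apply/eqP; rewrite -tofrac_eq !tofracM !tofracXn -fq -fp.
  by rewrite -!mulrA [_ ^+ n * _]mulrC.
have {e} := congr1 (horner_alg u) e.
rewrite !rmorphM !rmorphXn /= !horner_algX => e.
have uwn i : u ^+ i * w ^+ i = 1 by rewrite -exprMn uw expr1n.
by rewrite -[LHS]mulr1 -(uwn n) mulrACA -e mulrA -[_ * _ * _ ^+ m]mulrA uwn mulr1.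
Qed.

Lemma laurent_evalP (f : laurent) :
  exists n p, laurent_val f * ('X : {poly k})%:F ^+ n = p%:F.
Proof. exact/asboolP/laurentP. Qed.

Lemma laurent_eval_zmod : zmod_morphism ev.
Proof.
move=> f g; have [n [p fE]] := laurent_evalP f; have [m [q gE]] := laurent_evalP g.
rewrite (laurent_evalE fE) (laurent_evalE gE).
rewrite (@laurent_evalE _ (n + m) (p * 'X^m - q * 'X^n)); last first.
  rewrite tofracB !tofracM !tofracXn -fE -gE mulrBl.
  by rewrite exprD mulrA [_ ^+ n * _]mulrC mulrA.
have uwn i : u ^+ i * w ^+ i = 1 by rewrite -exprMn uw expr1n.
rewrite rmorphB !rmorphM !rmorphXn /= !horner_algX mulrBl exprD.
congr (_ - _); first by rewrite [w ^+ n * _]mulrC mulrA -[_ * _ * w ^+ m]mulrA uwn mulr1.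
by rewrite mulrA -[_ * _ * w ^+ n]mulrA uwn mulr1.
Qed.

Lemma laurent_eval_monoid : monoid_morphism ev.
Proof.
split=> [|f g].
  rewrite (@laurent_evalE _ 0 1) ?rmorph1 ?mulr1 //.
have [n [p fE]] := laurent_evalP f; have [m [q gE]] := laurent_evalP g.
rewrite (laurent_evalE fE) (laurent_evalE gE).
rewrite (@laurent_evalE _ (n + m) (p * q)).
  by rewrite rmorphM exprD mulrACA.
by rewrite tofracM -fE -gE exprD mulrACA.
Qed.

Lemma laurent_eval_scalable : scalable ev.
Proof.
move=> c f; have [n [p fE]] := laurent_evalP f.
rewrite (laurent_evalE fE) (@laurent_evalE _ n (c *: p)).
  have -> : horner_alg u (c *: p) = c *: horner_alg u p.
    by rewrite -mul_polyC rmorphM /= horner_algC mulr_algl.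
  exact: (esym (scalerAl _ _ _)).
by rewrite /= -mulrA fE -tofracM mul_polyC.
Qed.

HB.instance Definition _ := GRing.isZmodMorphism.Build laurent A ev laurent_eval_zmod.
HB.instance Definition _ := GRing.isMonoidMorphism.Build laurent A ev laurent_eval_monoid.
HB.instance Definition _ := GRing.isScalable.Build k laurent A *:%R ev laurent_eval_scalable.

Lemma laurent_eval_lX : ev (lX 1) = u.
Proof.
by rewrite (@laurent_evalE _ 0 'X) ?mulr1 ?horner_algX //= mulr1 expr1z.
Qed.
End Eval.
End Laurent.

(* Free modules on a set, and the semilinear map between two of them induced by
   a ring morphism and an injection of the bases. *)
Section FreeModule.

Lemma fgU_scale (R : nzRingType) (T : choiceType) (c : R) (x : T) :
  << c *g x >> = c *: << x >> :> {freeg T / R}.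
Proof.
by apply/eqP/freeg_eqP=> y; rewrite coeffZ !coeffU mul1r.
Qed.

Section Semilinear.
Variables (R S : nzRingType) (T U : choiceType).
Variables (rho : {rmorphism R -> S}) (i : T -> U).
Hypothesis i_inj : injective i.

Definition fgpush (D : {freeg T / R}) : {freeg U / S} :=
  \sum_(x <- dom D) << rho (coeff x D) *g i x >>.

Lemma coeff_fgpush D x : coeff (i x) (fgpush D) = rho (coeff x D).
Proof.
rewrite /fgpush raddf_sum /=; have [xD|xD] := boolP (x \in dom D).
  rewrite (bigD1_seq x) ?uniq_dom //= big1 ?addr0 => [|y yx].
    by rewrite coeffU eqxx mulr1.
  by rewrite coeffU (inj_eq i_inj) (negbTE yx) mulr0.
rewrite (coeff_outdom xD) rmorph0 big_seq big1 // => y yD.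
rewrite coeffU (inj_eq i_inj); case: eqP yD xD => [-> ->//|_ _ _].
by rewrite mulr0.
Qed.

Lemma coeff_fgpush_out D y : (forall x, i x <> y) -> coeff y (fgpush D) = 0.
Proof.
move=> iy; rewrite /fgpush raddf_sum /= big1 // => x _.
by rewrite coeffU; case: eqP => [/iy//|_]; rewrite mulr0.
Qed.

Lemma fgpush_ext (D : {freeg T / R}) (E : {freeg U / S}) :
  (forall x, coeff (i x) E = rho (coeff x D)) ->
  (forall y, (forall x, i x <> y) -> coeff y E = 0) -> fgpush D = E.
Proof.
move=> h1 h2; apply/eqP/freeg_eqP => y.
have [[x <-]|ny] := pselect (exists x, i x = y); first by rewrite coeff_fgpush h1.
have iy x : i x <> y by move=> e; apply: ny; exists x.
by rewrite coeff_fgpush_out // h2.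
Qed.

Lemma fgpush_zmod : zmod_morphism fgpush.
Proof.
move=> D E; apply: fgpush_ext => [x|y iy].
  by rewrite !coeffB !coeff_fgpush rmorphB.
by rewrite coeffB !coeff_fgpush_out // subrr.
Qed.

Lemma fgpush_semilinear a D : fgpush (a *: D) = rho a *: fgpush D.
Proof.
apply: fgpush_ext => [x|y iy]; rewrite !coeffZ ?coeff_fgpush ?rmorphM //.
by rewrite coeff_fgpush_out // mulr0.
Qed.

Lemma fgpushU x : fgpush << x >> = << i x >>.
Proof.
apply: fgpush_ext => [y|y iy]; rewrite !coeffU !mul1r.
  by rewrite (inj_eq i_inj) rmorph_nat.
by case: eqP => // /iy.
Qed.
End Semilinear.

Section Linear.
Variables (R : nzRingType) (T : choiceType) (M : lmodType R).

Lemma fglift_linear (f : T -> M) : linear (fglift f : {freeg T / R} -> M).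
Proof.
pose g : {additive {freeg T / R} -> M} :=
  HB.pack (fglift f : {freeg T / R} -> M) (GRing.isZmodMorphism.Build _ _ _ (lift_is_additive f)).
have gU c x : g << c *g x >> = c *: f x by exact: liftU.
move=> a D E; rewrite -[LHS]/(g _) -[fglift f D]/(g D) -[fglift f E]/(g E).
rewrite raddfD; congr (_ + _).
rewrite -[in RHS](freeg_sumE D).
have -> : a *: D = \sum_(x <- dom D) << a * coeff x D *g x >> by [].
rewrite !raddf_sum.
by apply: eq_bigr => x _; rewrite gU -[RHS]/(a *: g _) gU scalerA.
Qed.

HB.instance Definition _ (f : T -> M) :=
  GRing.isLinear.Build R {freeg T / R} M *:%R (fglift f) (fglift_linear f).

Lemma fg_ext (f g : {freeg T / R} -> M) : linear f -> linear g ->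
  (forall x, f << x >> = g << x >>) -> f =1 g.
Proof.
move=> fl gl fg D.
pose f' : {linear {freeg T / R} -> M} := HB.pack f (GRing.isLinear.Build R _ _ _ f fl).
pose g' : {linear {freeg T / R} -> M} := HB.pack g (GRing.isLinear.Build R _ _ _ g gl).
rewrite -[f D]/(f' D) -[g D]/(g' D) -[D]freeg_sumE !raddf_sum /=.
apply: eq_bigr => x _; rewrite fgU_scale.
by rewrite -[LHS]/(f' _) -[RHS]/(g' _) !linearZ /= fg.
Qed.
End Linear.
End FreeModule.

(* The category C_2V: [arrow A B] are the non-identity morphisms. No two of them
   compose, so a functor out of C_2V (or its opposite) is a value at each object
   together with a map for each arrow, without further condition. *)
Inductive obj := A1 | A2 | B1 | B2 | B3.

Definition obj_eq_dec (P Q : obj) : {P = Q} + {P <> Q}.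
Proof. by decide equality. Defined.

Inductive arrow : obj -> obj -> Type :=
| A1B1 : arrow A1 B1
| A2B2 : arrow A2 B2
| A1B3 : arrow A1 B3
| A2B3 : arrow A2 B3.

Lemma arrow_not_composable (A B C : obj) : arrow A B -> arrow B C -> False.
Proof. by case=> h; inversion h. Qed.

(* A sheaf of commutative k-algebras on C_2V. *)
Record ring_sheaf (k : fieldType) := RingSheaf {
  rval :> obj -> comAlgType k;
  rres : forall A B, arrow A B -> {lrmorphism rval B -> rval A} }.

(* The pairing identifies each space with the full k-linear dual of the other. *)
Definition perfect (k : fieldType) (V W : lmodType k) (b : V -> W -> k) :=
  [/\ forall v, linear (b v : W -> k^o),
      forall w, linear (b^~ w : V -> k^o),
      forall l : {linear W -> k^o}, exists! v, forall w, b v w = l w &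
      forall l : {linear V -> k^o}, exists! w, forall v, b v w = l v].

Section Modules.
Variables (k : fieldType) (O : ring_sheaf k).

Record omod := OMod {
  oval :> forall P : obj, lmodType (O P);
  ores : forall A B, arrow A B -> oval B -> oval A;
  ores_zmod : forall A B (h : arrow A B), zmod_morphism (ores h);
  ores_semilinear : forall A B (h : arrow A B) a m,
    ores h (a *: m) = rres O h a *: ores h m }.

HB.instance Definition _ (F : omod) A B (h : arrow A B) :=
  GRing.isZmodMorphism.Build (F B) (F A) (ores h) (ores_zmod h).

Record omor (F G : omod) := OMor {
  mor :> forall P, F P -> G P;
  mor_linear : forall P, linear (@mor P);
  mor_natural : forall A B (h : arrow A B) m, ores h (@mor B m) = @mor A (ores h m) }.
Arguments mor {F G} _ P _.

HB.instance Definition _ F G (f : omor F G) P :=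
  GRing.isLinear.Build (O P) (F P) (G P) *:%R (mor f P) (@mor_linear F G f P).

Lemma omorP F G (f g : omor F G) : (forall P, f P =1 g P) -> f = g.
Proof.
case: f g => f fl fn [g gl gn] /= fg.
have {}fg : f = g by apply: functional_extensionality_dep => P; apply/funext.
by subst g; congr OMor; apply: Prop_irrelevance.
Qed.

(* The k-vector space Hom_O(F, G). *)
Section Hom.
Variables F G : omod.
HB.instance Definition _ := gen_eqMixin (omor F G).
HB.instance Definition _ := gen_choiceMixin (omor F G).

Program Definition omor0 : omor F G := @OMor F G (fun P _ => 0) _ _.
Next Obligation. by move=> P a x y; rewrite scaler0 addr0. Qed.
Next Obligation. by move=> A B h m; rewrite raddf0. Qed.

Program Definition omorN (f : omor F G) : omor F G :=
  @OMor F G (fun P x => - f P x) _ _.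
Next Obligation. by move=> f P a x y; rewrite linearP opprD scalerN. Qed.
Next Obligation. by move=> f A B h m; rewrite raddfN /= mor_natural. Qed.

Program Definition omorD (f g : omor F G) : omor F G :=
  @OMor F G (fun P x => f P x + g P x) _ _.
Next Obligation.
by move=> f g P a x y; rewrite !linearP scalerDr addrACA.
Qed.
Next Obligation. by move=> f g A B h m; rewrite raddfD /= !mor_natural. Qed.

Program Definition omorZ (c : k) (f : omor F G) : omor F G :=
  @OMor F G (fun P x => (c%:A : O P) *: f P x) _ _.
Next Obligation.
by move=> c f P a x y; rewrite linearP scalerDr !scalerA mulrC.
Qed.
Next Obligation.
by move=> c f A B h m; rewrite ores_semilinear mor_natural rmorph_alg.
Qed.

Lemma omorDA : associative omorD.
Proof. by move=> f g h; apply: omorP => P x /=; rewrite addrA. Qed.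
Lemma omorDC : commutative omorD.
Proof. by move=> f g; apply: omorP => P x /=; rewrite addrC. Qed.
Lemma omor0D : left_id omor0 omorD.
Proof. by move=> f; apply: omorP => P x /=; rewrite add0r. Qed.
Lemma omorND : left_inverse omor0 omorN omorD.
Proof. by move=> f; apply: omorP => P x /=; rewrite addNr. Qed.
HB.instance Definition _ :=
  GRing.isZmodule.Build (omor F G) omorDA omorDC omor0D omorND.

Lemma omorZA a b f : omorZ a (omorZ b f) = omorZ (a * b) f.
Proof. by apply: omorP => P x /=; rewrite scalerA -scalerAl mul1r scalerA. Qed.
Lemma omorZ1 : left_id 1 omorZ.
Proof. by move=> f; apply: omorP => P x /=; rewrite !scale1r. Qed.
Lemma omorZDr : right_distributive omorZ +%R.
Proof. by move=> a f g; apply: omorP => P x /=; rewrite scalerDr. Qed.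
Lemma omorZDl f : {morph omorZ^~ f : a b / a + b}.
Proof. by move=> a b; apply: omorP => P x /=; rewrite !scalerDl. Qed.
HB.instance Definition _ := GRing.Zmodule_isLmodule.Build k (omor F G)
  omorZA omorZ1 omorZDr omorZDl.
End Hom.

Program Definition ocomp F G H (g : omor G H) (f : omor F G) : omor F H :=
  @OMor F H (fun P => g P \o f P) _ _.
Next Obligation. by move=> F G H g f P a x y; rewrite /= !linearP. Qed.
Next Obligation. by move=> F G H g f A B h m; rewrite /= !mor_natural. Qed.

Definition precomp F G H (f : omor F G) (g : omor G H) : omor F H := ocomp g f.
Lemma precomp_linear F G H (f : omor F G) : linear (@precomp F G H f).
Proof. by move=> a g g'; apply: omorP. Qed.
HB.instance Definition _ F G H (f : omor F G) :=
  GRing.isLinear.Build k (omor G H) (omor F H) *:%R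
    (@precomp F G H f) (@precomp_linear F G H f).

Program Definition oker F G (f : omor F G) : omod :=
  @OMod (fun P => kernel (f P))
    (fun A B h m => @Kernel _ _ _ (f A) (ores h (ker_val m)) _) _ _.
Next Obligation.
by move=> F G f A B h [m /= /eqP fm]; rewrite in_kerE /= -mor_natural fm raddf0.
Qed.
Next Obligation. by move=> F G f A B h x y; apply: val_inj; rewrite /= raddfB. Qed.
Next Obligation.
by move=> F G f A B h a x; apply: val_inj; rewrite /= ores_semilinear.
Qed.

Program Definition oker_incl F G (f : omor F G) : omor (oker f) F :=
  @OMor (oker f) F (fun P (m : kernel (f P)) => ker_val m) _ _.
Next Obligation. by []. Qed.
Next Obligation. by []. Qed.

(* Epimorphisms and exactness of O-modules are tested at each object. *)
Definition oepi F G (f : omor F G) := forall P (y : G P), exists x, f P x = y.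

Definition projective (X : omod) := forall F G (e : omor F G) (f : omor X G),
  oepi e -> exists g : omor X F, ocomp e g = f.

Definition oexact F G H (f : omor F G) (g : omor G H) :=
  forall P (y : G P), g P y = 0 <-> exists x, f P x = y.

Record resolution (F : omod) := Resolution {
  rterm :> nat -> omod;
  rdiff : forall n, omor (rterm n.+1) (rterm n);
  raug : omor (rterm 0) F;
  rterm_projective : forall n, projective (rterm n);
  raug_epi : oepi raug;
  rexact0 : oexact (rdiff 0) raug;
  rexact : forall n, oexact (rdiff n.+1) (rdiff n) }.

(* There are enough projectives: a free cover of F. Its value at P is free over
   O(P) on the elements of F(P) and the restrictions to P, kept formal, of the
   elements of F(B) for the arrows P -> B. *)
Section Cover.
Variable F : omod.

Definition gen (P : obj) : Type := (F P + {B : obj & (arrow P B * F B)%type})%type.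

Definition gen_val P (x : gen P) : F P :=
  match x with inl m => m | inr (existT B (h, m)) => ores h m end.

Definition gen_res A B (h : arrow A B) (x : gen B) : gen A :=
  match x with
  | inl m => inr (existT _ B (h, m))
  | inr (existT C (h', m)) => False_rect _ (arrow_not_composable h h')
  end.

Lemma gen_res_inj A B (h : arrow A B) : injective (gen_res h).
Proof.
case=> [m|[C [h' m]]]; last by case: (arrow_not_composable h h').
case=> [m'|[C [h' m']]]; last by case: (arrow_not_composable h h').
by case=> E; congr inl; apply: (Eqdep_dec.inj_pair2_eq_dec _ obj_eq_dec _ _ _ _ E).
Qed.

Lemma gen_resE A B (h : arrow A B) x : gen_val (gen_res h x) = ores h (gen_val x).
Proof. by case: x => [//|[C [h' m]]]; case: (arrow_not_composable h h'). Qed.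

Definition cgen P : choiceType := {classic gen P}.

Program Definition cover : omod :=
  @OMod (fun P => {freeg (cgen P) / (O P)})
    (fun A B h => @fgpush (O B) (O A) (cgen B) (cgen A) (rres O h) (gen_res h)) _ _.
Next Obligation. by move=> A B h; apply/fgpush_zmod/gen_res_inj. Qed.
Next Obligation. by move=> A B h a m; apply/fgpush_semilinear/gen_res_inj. Qed.

Lemma cover_ext_natural (G : omod) A B (h : arrow A B)
    (u v : {freeg (cgen B) / (O B)} -> G A) :
  zmod_morphism u -> zmod_morphism v ->
  (forall a x, u (a *: x) = rres O h a *: u x) ->
  (forall a x, v (a *: x) = rres O h a *: v x) ->
  (forall x, u << x >> = v << x >>) -> u =1 v.
Proof.
move=> ua va us vs uv D.
pose u' : {additive {freeg (cgen B) / (O B)} -> G A} :=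
  HB.pack u (GRing.isZmodMorphism.Build _ _ u ua).
pose v' : {additive {freeg (cgen B) / (O B)} -> G A} :=
  HB.pack v (GRing.isZmodMorphism.Build _ _ v va).
rewrite -[D]freeg_sumE -[LHS]/(u' _) -[RHS]/(v' _) !raddf_sum.
apply: eq_bigr => x _; rewrite -[LHS]/(u _) -[RHS]/(v _).
by rewrite fgU_scale us vs uv.
Qed.

Section CoverMor.
Variables (G : omod) (g : forall P, gen P -> G P).
Hypothesis g_nat : forall A B (h : arrow A B) x, g (gen_res h x) = ores h (g x).

Program Definition cover_mor : omor cover G :=
  @OMor cover G (fun P => fglift (@g P : cgen P -> G P)) _ _.
Next Obligation. by move=> P; apply: fglift_linear. Qed.
Next Obligation.
move=> A B h m.
pose fB : {linear {freeg (cgen B) / (O B)} -> G B} := fglift (@g B : cgen B -> G B).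
pose fA : {linear {freeg (cgen A) / (O A)} -> G A} := fglift (@g A : cgen A -> G A).
apply: (@cover_ext_natural G A B h (ores h \o fB) (fA \o @ores cover A B h)) => /=.
- by move=> x y; rewrite [LHS]/= [fB _](raddfB fB) raddfB.
- by move=> x y; rewrite -[LHS]/(fA (@ores cover A B h (x - y))) ores_zmod raddfB.
- by move=> a x /=; rewrite linearZ /= ores_semilinear.
- move=> a x; rewrite -[LHS]/(fA (@ores cover A B h (a *: x))).
  by rewrite ores_semilinear linearZ.
move=> x /=; rewrite liftU scale1r -g_nat.
by rewrite fgpushU ?liftU ?scale1r //; apply: gen_res_inj.
Qed.

Lemma cover_morE P (x : gen P) : cover_mor P << (x : cgen P) >> = g x.
Proof. by rewrite /= liftU scale1r. Qed.
End CoverMor.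

Definition cover_aug : omor cover F := cover_mor gen_resE.

Lemma cover_aug_epi : oepi cover_aug.
Proof. by move=> P y; exists << (inl y : cgen P) >>; rewrite cover_morE. Qed.

Lemma cover_projective : projective cover.
Proof.
move=> G H e f e_epi.
have [s sP] : {s : forall P, F P -> G P |
    forall P m, e P (s P m) = f P << (inl m : cgen P) >>}.
  exists (fun P m => projT1 (cid (e_epi P (f P << (inl m : cgen P) >>)))) => P m.
  by case: cid.
pose g P (x : gen P) : G P :=
  match x with inl m => s P m | inr (existT B (h, m)) => ores h (s B m) end.
have g_nat A B (h : arrow A B) x : g A (gen_res h x) = ores h (g B x).
  by case: x => [//|[C [h' m]]]; case: (arrow_not_composable h h').
exists (cover_mor g_nat); apply: omorP => P.
apply: (@fg_ext (O P) (cgen P) (H P) (ocomp e (cover_mor g_nat) P) (f P)) => [||x].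
- exact: (@mor_linear _ _ (ocomp e (cover_mor g_nat)) P).
- exact: (@mor_linear _ _ f P).
rewrite /= -[fglift _ _]/(cover_mor g_nat P _) cover_morE.
case: x => [m|[B [h m]]] /=; first exact: sP.
rewrite -mor_natural sP mor_natural; congr (f P _).
by rewrite /= fgpushU //; apply: gen_res_inj.
Qed.
End Cover.

Section FreeResolution.
Variable F : omod.

Fixpoint syzygy n : omod :=
  if n is m.+1 then oker (cover_aug (syzygy m)) else F.

Definition free_diff n : omor (cover (syzygy n.+1)) (cover (syzygy n)) :=
  ocomp (oker_incl (cover_aug (syzygy n))) (cover_aug (syzygy n.+1)).

Lemma free_exact0 n : oexact (free_diff n) (cover_aug (syzygy n)).
Proof.
move=> P y; split=> [y0|[x <-]]; last exact/eqP/kerP.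
have yk : y \in in_ker (cover_aug (syzygy n) P) by apply/eqP.
have [x xy] := @cover_aug_epi (syzygy n.+1) P (Kernel yk).
by exists x; rewrite /free_diff /ocomp /= -[fglift _ _]/(cover_aug (syzygy n.+1) P x) xy.
Qed.

Lemma free_exact n : oexact (free_diff n.+1) (free_diff n).
Proof.
move=> P y; rewrite -free_exact0; split=> [|y0]; last by rewrite /= [fglift _ _]y0.
by move=> y0; apply: val_inj.
Qed.

Definition free_resolution : resolution F :=
  Resolution (fun n => @cover_projective (syzygy n)) (@cover_aug_epi F)
    (@free_exact0 0) free_exact.
End FreeResolution.

(* Ext^i(F, G) is the i-th cohomology of Hom(P, G), where P is the resolution of
   F by free covers. *)
Section Ext.
Variables F G : omod.
Let P := free_resolution F.

Definition cocycle (i : nat) : lmodType k := kernel (@precomp _ _ G (rdiff P i)).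

Definition is_coboundary (i : nat) : cocycle i -> Prop :=
  match i with
  | 0 => fun f => f = 0
  | j.+1 => fun f => exists g : omor (rterm P j) G, precomp (rdiff P j) g = ker_val f
  end.
Definition coboundary (i : nat) : {pred cocycle i} := fun f => `[< is_coboundary f >].
Lemma coboundary_submod i : subsemimod_closed (@coboundary i).
Proof.
split; first split; case: i => [|i].
- by apply/asboolP.
- by apply/asboolP; exists 0; rewrite linear0.
- by move=> f g /asboolP /= -> /asboolP /= ->; apply/asboolP; rewrite /= addr0.
- move=> f g /asboolP[u uf] /asboolP[v vg]; apply/asboolP; exists (u + v).
  by rewrite linearD /= uf vg.
- by move=> a f /asboolP /= ->; apply/asboolP; rewrite /= scaler0.
- move=> a f /asboolP[u uf]; apply/asboolP; exists (a *: u).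
  by rewrite linearZ /= uf.
Qed.
HB.instance Definition _ i :=
  GRing.isSubmodClosed.Build k (cocycle i) (@coboundary i) (@coboundary_submod i).

Definition Ext (i : nat) : lmodType k := qmod (@coboundary i).
Definition ext_class i (f : cocycle i) : Ext i := qclass _ f.
End Ext.

Section Yoneda.

(* t is a chain map from the resolution of F, truncated below degree i and
   shifted, to the resolution of G, and it lifts the cocycle f : P_i -> G. *)
Definition is_lift F G i (f : cocycle F G i)
    (t : forall n, omor (rterm (free_resolution F) (n + i))
                        (rterm (free_resolution G) n)) : Prop :=
  ocomp (raug (free_resolution G)) (t 0) = ker_val f /\
  forall n, ocomp (rdiff (free_resolution G) n) (t n.+1) =
            ocomp (t n) (rdiff (free_resolution F) (n + i)).

Lemma yoneda_subproof F G H i j (f : cocycle F G i) (g : cocycle G H j) t :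
  is_lift f t ->
  ocomp (ker_val g) (t j) \in
    in_ker (@precomp _ _ H (rdiff (free_resolution F) (j + i))).
Proof.
case=> _ tP; rewrite in_kerE; apply/eqP/omorP => P x.
have := congr1 (fun u => mor u P x) (tP j); rewrite /= => <-.
by have /eqP/(congr1 (fun u => mor u P (t j.+1 P x))) := kerP g.
Qed.

Definition yoneda_cocycle F G H i j (f : cocycle F G i) (g : cocycle G H j) t
    (ft : is_lift f t) : cocycle F H (j + i) := Kernel (yoneda_subproof g ft).

Lemma projective_lift X F G H (u : omor F G) (v : omor G H) (w : omor X G) :
  projective X -> oexact u v -> ocomp v w = 0 -> exists z, ocomp u z = w.
Proof.
move=> Xp uv vw.
have uk P x : u P x \in in_ker (v P) by apply/eqP/uv; exists x.
have wk P x : w P x \in in_ker (v P).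
  by apply/eqP; apply: (congr1 (fun h => mor h P x) vw).
have ul P : linear (fun x => Kernel (uk P x)).
  by move=> a x y; apply: val_inj; rewrite /= linearP.
have wl P : linear (fun x => Kernel (wk P x)).
  by move=> a x y; apply: val_inj; rewrite /= linearP.
have un A B (h : arrow A B) m : @ores (oker v) A B h (Kernel (uk B m)) = Kernel (uk A (ores h m)).
  by apply: val_inj; rewrite /= mor_natural.
have wn A B (h : arrow A B) m : @ores (oker v) A B h (Kernel (wk B m)) = Kernel (wk A (ores h m)).
  by apply: val_inj; rewrite /= mor_natural.
have [|z zP] := Xp _ _ (@OMor F (oker v) _ ul un) (@OMor X (oker v) _ wl wn).
  move=> P [y yk]; have [x xy] : exists x, u P x = y by apply/uv/eqP.
  by exists x; apply: val_inj.
exists z; apply: omorP => P x.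
by have := congr1 (fun h : omor X (oker v) => ker_val (h P x : kernel (v P))) zP.
Qed.

Lemma lift_exists F G i (f : cocycle F G i) : exists t, is_lift f t.
Proof.
set P := free_resolution F; set Q := free_resolution G.
have [t0 t0P] : exists t0 : omor (rterm P i) (rterm Q 0), ocomp (raug Q) t0 = ker_val f.
  exact: (@rterm_projective _ P i _ _ (raug Q) (ker_val f) (@raug_epi _ Q)).
have [t1 t1P] : exists t1 : omor (rterm P i.+1) (rterm Q 1),
    ocomp (rdiff Q 0) t1 = ocomp t0 (rdiff P i).
  apply: (projective_lift (@rterm_projective _ P i.+1) (@rexact0 _ Q)).
  apply: omorP => A x; have /eqP fk := kerP f.
  rewrite -[LHS]/(ocomp (raug Q) t0 A (rdiff P i A x)) t0P.
  exact: (congr1 (fun u : omor (rterm P i.+1) G => mor u A x) fk).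
pose S n := {p : omor (rterm P (n + i)) (rterm Q n) *
    omor (rterm P (n.+1 + i)) (rterm Q n.+1) |
    ocomp (rdiff Q n) p.2 = ocomp p.1 (rdiff P (n + i))}.
have step n (s : S n) : {s' : S n.+1 | (sval s').1 = (sval s).2}.
  apply: cid; case: s => [[a b] /= ab].
  have [c cP] : exists c : omor (rterm P (n.+2 + i)) (rterm Q n.+2),
      ocomp (rdiff Q n.+1) c = ocomp b (rdiff P (n.+1 + i)).
    apply: (projective_lift (@rterm_projective _ P (n.+2 + i)) (@rexact _ Q n)).
    apply: omorP => A x.
    rewrite -[LHS]/(ocomp (rdiff Q n) b A (rdiff P (n.+1 + i) A x)) ab.
    have E : rdiff P (n + i) A (rdiff P (n.+1 + i) A x) = 0.
      by apply/(@rexact _ P); exists x.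
    exact: (etrans (congr1 (a A) E) (linear0 (a A))).
  by exists (exist _ (b, c) cP).
pose s := fix s n : S n :=
  match n with 0 => exist _ (t0, t1) t1P | m.+1 => sval (step m (s m)) end.
exists (fun n => (sval (s n)).1); split=> // n.
by rewrite /= (svalP (step n (s n))); apply: (svalP (s n)).
Qed.

(* b is the Yoneda product: on all representatives f, g and all lifts t of f,
   it is the class of g o t_j. By [lift_exists] there is at most one such b. *)
Definition is_yoneda F G H i j (b : Ext F G i -> Ext G H j -> Ext F H (j + i)) :=
  forall (f : cocycle F G i) (g : cocycle G H j) t (ft : is_lift f t),
    b (ext_class f) (ext_class g) = ext_class (yoneda_cocycle g ft).
End Yoneda.

Program Definition structure_sheaf : omod :=
  @OMod (fun P => (O P)^o) (fun A B h => rres O h) _ _.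
Next Obligation. by move=> A B h x y; rewrite rmorphB. Qed.
Next Obligation. by move=> A B h a m; rewrite [LHS]rmorphM. Qed.

(* H^i(F) = Ext^i(O, F). *)
Definition coh (F : omod) (i : nat) : lmodType k := Ext structure_sheaf F i.

Definition strong_duality (omega : omod) (phi : coh omega 1 -> k) (F : omod) :=
  [/\ exists b : coh F 0 -> Ext F omega 1 -> coh omega 1,
        is_yoneda b /\ perfect (fun x y => phi (b x y)),
      exists b : coh F 1 -> Ext F omega 0 -> coh omega 1,
        is_yoneda b /\ perfect (fun x y => phi (b x y)),
      forall i, (2 <= i)%N -> forall x : coh F i, x = 0 &
      forall i, (2 <= i)%N -> forall x : Ext F omega i, x = 0].

Program Definition sky1 (N : lmodType (O B1)) : omod :=
  @OMod (fun P => match P return lmodType (O P) with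
                  | B1 => N | P' => 'rV[O P']_0 end)
    (fun A B h => fun=> 0) _ _.
Next Obligation. by move=> N A B h x y; rewrite subr0. Qed.
Next Obligation. by move=> N A B h a m; rewrite scaler0. Qed.

Program Definition sky2 (N : lmodType (O B2)) : omod :=
  @OMod (fun P => match P return lmodType (O P) with
                  | B2 => N | P' => 'rV[O P']_0 end)
    (fun A B h => fun=> 0) _ _.
Next Obligation. by move=> N A B h x y; rewrite subr0. Qed.
Next Obligation. by move=> N A B h a m; rewrite scaler0. Qed.
End Modules.

(* The sheaf of rings O_{k,r}. *)
Section Okr.
Variables (k : fieldType) (r : nat).

Definition Okr : ring_sheaf k := @RingSheaf k
  (fun P => match P return comAlgType k with
            | B1 | B2 => {poly k} | _ => laurent k end)
  (fun A B h => match h with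
    | A1B1 => poly_eval (lX k (-1))
    | A2B2 => poly_eval (lX k (-1))
    | A1B3 => laurent_eval (lXV k r%:Z)
    | A2B3 => laurent_eval (lXNV k r%:Z)
    end).

Variable d : int * int.

(* The module M_{k,r,d}; the basis e_1, ..., e_r of the value at B3 is indexed
   from 0, so that e_j restricts to x^j. *)
Definition Mkrd_val (P : obj) : lmodType (Okr P) :=
  match P return lmodType (Okr P) with
  | B3 => 'rV[laurent k]_r
  | P' => (Okr P')^o
  end.

Definition Mkrd_res A B (h : arrow A B) : Mkrd_val B -> Mkrd_val A :=
  match h in arrow A B return Mkrd_val B -> Mkrd_val A with
  | A1B1 => fun m => rres Okr A1B1 m * lX k d.1
  | A2B2 => fun m => rres Okr A2B2 m * lX k d.2
  | A1B3 => fun m : 'rV_r => \sum_(j < r) rres Okr A1B3 (m 0 j) * lX k j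
  | A2B3 => fun m : 'rV_r => \sum_(j < r) rres Okr A2B3 (m 0 j) * lX k j
  end.

Lemma Mkrd_zmod A B (h : arrow A B) : zmod_morphism (Mkrd_res h).
Proof.
case: h => x y /=; rewrite ?rmorphB ?mulrBl // -sumrB; apply: eq_bigr => j _;
by rewrite !mxE rmorphB mulrBl.
Qed.
Lemma Mkrd_semilinear A B (h : arrow A B) (a : Okr B) (m : Mkrd_val B) :
  Mkrd_res h (a *: m) = rres Okr h a *: Mkrd_res h m.
Proof.
case: h a m => a m /=; rewrite ?[X in X * _]rmorphM /= -?mulrA // scaler_sumr;
apply: eq_bigr => j _; by rewrite !mxE rmorphM /= -mulrA.
Qed.

Definition Mkrd : omod Okr := OMod Mkrd_zmod Mkrd_semilinear.
End Okr.

Definition omega_kr (k : fieldType) (r : nat) : omod (Okr k r) :=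
  Mkrd k r (r%:Z - 2, r%:Z - 2).

(* k[y] / y k[y], as a k[y]-module. *)
Definition k_y (k : fieldType) : lmodType {poly k} := qmod (principal ('X : {poly k})).

(* Main.v *)
Require Import Defs.
From HB Require Import structures.
From mathcomp Require Import all_boot all_order all_algebra.
From mathcomp Require Import boolp zify.
Import Order.TTheory GRing.Theory Num.Theory.
Local Open Scope ring_scope.

Set Implicit Arguments.
Unset Strict Implicit.
Unset Printing Implicit Defensive.
#[local] Obligation Tactic := idtac.

(* Each of the sheaves F considered (the structure sheaf and the two skyscrapers) is a
   quotient pi : O -> F whose kernel at P is a principal ideal (z P).  Let X -> F be an
   epimorphism from a projective, K its kernel, and base P in X P a lift of pi 1.  Modulo
   restrictions of morphisms X -> G, a morphism K -> G is determined by its values at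
   z P *: base P and at base A - res (base B).  Hence K is projective, Ext^i(F, G) = 0 for
   i >= 2, and Ext^1(F, G) is read off those values.  For F = O this is the Cech description
   of H^1: the coefficient of x_1^(r-1) minus that of x_2^(r-1) gives H^1(omega) = k.  For
   the skyscraper at B_i, z = y_i becomes a unit at A_i, so that Ext^1(F, omega) =
   omega(B_i) / y_i = k while Hom(F, omega) = 0; moreover H^0(F) = k and H^1(F) = 0.  The
   Yoneda product of c in H^0(F) with the class of w in k[y_i] is represented by the Cech
   cocycle c x_i w(1/x_i) x_i^(r-2) on A_i, whose residue is c w(0) up to sign. *)

(** * Modules, syzygies and Ext *)

Section Modules.
Variables (k : fieldType) (O : ring_sheaf k).
Implicit Types F G X Y : omod O.

Lemma omorE F G (f g : omor F G) : f = g -> forall P x, f P x = g P x.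
Proof. by move=> ->. Qed.

Lemma mk_omor F G (f : forall P, F P -> G P) : (forall P, linear (f P)) ->
  (forall A B (h : arrow A B) m, ores h (f B m) = f A (ores h m)) ->
  exists g : omor F G, forall P x, g P x = f P x.
Proof. by move=> fl fn; exists (OMor fl fn). Qed.

(** Surjectivity at each object gives a section of sets. Since [f] kills the kernel of [e], its
    value at a preimage is independent of the choice, whence linearity and naturality. *)
Lemma epi_factor F G H (e : omor F G) (f : omor F H) : oepi e ->
  (forall P x, e P x = 0 -> f P x = 0) -> exists g, ocomp g e = f.
Proof.
move=> e_epi ef; pose s P (y : G P) := projT1 (cid (e_epi P y)).
have sK P y : e P (s P y) = y by rewrite /s; case: cid.
have fs P x y : e P x = y -> f P (s P y) = f P x.
  move=> xy; apply/eqP; rewrite -subr_eq0 -linearB; apply/eqP/ef.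
  by rewrite linearB /= sK xy subrr.
have [||g gE] := @mk_omor G H (fun P y => f P (s P y)).
- by move=> P a x y; rewrite (fs _ (a *: s P x + s P y)) linearP /= ?sK.
- by move=> A B h m; rewrite mor_natural (fs _ (ores h (s B m))) // -mor_natural sK.
by exists g; apply: omorP => P x; rewrite /= gE; apply: fs.
Qed.

Definition oid F : omor F F :=
  @OMor k O F F (fun P x => x) (fun _ _ _ _ => erefl) (fun _ _ _ _ => erefl).

Program Definition ozero : omod O :=
  @OMod k O (fun P => 'rV[O P]_0) (fun A B h => fun=> 0) _ _.
Next Obligation. by move=> A B h x y; rewrite subr0. Qed.
Next Obligation. by move=> A B h a m; rewrite scaler0. Qed.

Lemma retract_projective X Y (i : omor Y X) (r : omor X Y) :
  projective X -> ocomp r i = oid Y -> projective Y.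
Proof.
move=> Xp ri F G e f e_epi; have [g ge] := Xp _ _ e (ocomp f r) e_epi.
exists (ocomp g i); apply: omorP => P y.
rewrite -[LHS]/(ocomp e g P (i P y)) ge.
exact: (congr1 (f P) (omorE ri y)).
Qed.

(** A section [s] of [p] exists by projectivity of [Y], and [x - s (p x)] retracts [X] onto the
    kernel. *)
Lemma oker_retract X Y (p : omor X Y) : projective Y -> oepi p ->
  exists r : omor X (oker p), ocomp r (oker_incl p) = oid (oker p).
Proof.
move=> Yp p_epi; have [s sE] := Yp _ _ p (oid Y) p_epi.
have kr P x : x - s P (p P x) \in in_ker (p P).
  by rewrite in_kerE linearB /= (omorE sE : forall P x, p P (s P x) = x) subrr.
have [||r rE] := @mk_omor X (oker p) (fun P x => Kernel (kr P x)).
- move=> P a x y; apply: val_inj => /=.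
  by rewrite !linearP /= scalerDr addrACA.
- by move=> A B h m; apply: val_inj; rewrite /= raddfB /= !mor_natural.
exists r; apply: omorP => P [x /= xk]; rewrite rE; apply: val_inj => /=.
by have /eqP -> := xk; rewrite linear0 subr0.
Qed.

(* The extension of the structure sheaf by G whose Cech cocycle is d. *)
Section Twist.
Variables (G : omod O) (d : forall A B, arrow A B -> G A).

Program Definition twist : omod O :=
  @OMod k O (fun P => (G P * (O P)^o)%type)
   (fun A B h x => (ores h x.1 + rres O h x.2 *: d h, rres O h x.2)) _ _.
Next Obligation.
move=> A B h x y /=; rewrite !raddfB scalerBl /=.
by apply: (congr2 pair); rewrite // addrACA -opprD.
Qed.
Next Obligation.
move=> A B h a [m b]; apply: (congr2 pair); last exact: rmorphM.
by rewrite /= ores_semilinear [rres O h (a * b)]rmorphM scalerDr scalerA.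
Qed.
End Twist.

End Modules.

(** * Morphisms out of the syzygy of a cyclic module *)

Section Syzygy.
Variables (k : fieldType) (O : ring_sheaf k).
Variables (X F : omod O) (p : omor X F) (pi : omor (structure_sheaf O) F).
Variables (z : forall P, O P) (base : forall P, X P).
Hypotheses (X_proj : projective X) (pi_epi : oepi pi).
Hypothesis pi_ker : forall P a, pi P a = 0 <-> exists t, a = t * z P.
Hypothesis baseE : forall P, p P (base P) = pi P 1.
Let K := oker p.

Lemma structure_morE P a : pi P a = a *: pi P 1.
Proof. by rewrite -linearZ; congr (pi P _); rewrite /= [RHS]mulr1. Qed.

(** The linear maps [tau P] push [X] into [K], up to sign a retraction modulo multiples of [base].
    They are not natural: the defect along an arrow [h] is a multiple of [dbase h]. *)
Lemma tau_exists : exists (ka : omor X (structure_sheaf O)) (tau : forall P, X P -> K P),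
  [/\ ocomp pi ka = p, forall P, linear (tau P) &
      forall P x, ker_val (tau P x) = (ka P x : O P) *: base P - x].
Proof.
have [ka kaE] := X_proj p pi_epi; exists ka.
have tk P x : (ka P x : O P) *: base P - x \in in_ker (p P).
  rewrite in_kerE linearB linearZ /= baseE -structure_morE.
  by rewrite (omorE kaE x : pi P (ka P x) = _) subrr.
exists (fun P x => Kernel (tk P x)); split=> // P a x y; apply: val_inj => /=.
by rewrite linearP scalerDl -scalerA scalerBr opprD addrACA.
Qed.

Lemma zbase_ker P : z P *: base P \in in_ker (p P).
Proof.
rewrite in_kerE linearZ /= baseE -structure_morE; apply/eqP/pi_ker.
by exists 1; rewrite mul1r.
Qed.

Lemma dbase_ker A B (h : arrow A B) : base A - ores h (base B) \in in_ker (p A).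
Proof.
rewrite in_kerE linearB /= -mor_natural !baseE mor_natural subr_eq0.
by rewrite /= rmorph1.
Qed.

Definition zbase P : K P := Kernel (zbase_ker P).
Definition dbase A B (h : arrow A B) : K A := Kernel (dbase_ker h).

(** Naturality of [pi] makes restriction respect the ideals generated by [z]. *)
Lemma res_z A B (h : arrow A B) : exists w, rres O h (z B) = w * z A.
Proof.
apply/pi_ker; rewrite -[rres O h _]/(ores (o := structure_sheaf O) h (z B)).
rewrite -(mor_natural pi) (_ : pi B (z B) = 0) ?raddf0 //.
by apply/pi_ker; exists 1; rewrite mul1r.
Qed.

(* The extension is [x |-> ka x *: n - f (ka x *: base - x)], for a lift [ka : X -> O] of
   [p] through [pi]. *)
Lemma oker_extend G (f : omor K G) (n : forall P, G P) :
  (forall P, f P (zbase P) = z P *: n P) ->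
  (forall A B (h : arrow A B), f A (dbase h) = n A - ores h (n B)) ->
  exists g : omor X G, ocomp g (oker_incl p) = f.
Proof.
move=> fz fd; have [ka [tau [kaE taul tauE]]] := tau_exists.
have [||g gE] := @mk_omor _ _ X G (fun P x => (ka P x : O P) *: n P - f P (tau P x)).
- move=> P a x y; rewrite taul !(linearP (ka P)) (linearP (f P)) scalerDl.
  by rewrite -scalerA scalerBr opprD addrACA.
- move=> A B h x; rewrite raddfB /= ores_semilinear mor_natural.
  have kan : rres O h (ka B x) = ka A (ores h x) by rewrite -(mor_natural ka).
  have -> : ores h (tau B x) = tau A (ores h x) - (ka A (ores h x) : O A) *: dbase h.
    apply: val_inj; rewrite /= !tauE raddfB /= ores_semilinear kan scalerBr.
    by rewrite opprB [RHS]addrC addrA subrK.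
  rewrite linearB linearZ /= fd kan scalerBr opprB addrA.
  by congr (_ - _); rewrite addrC subrK.
exists g; apply: omorP => P [x xk]; rewrite /= gE.
have /pi_ker[t kat] : pi P (ka P x) = 0.
  by rewrite (omorE kaE x : pi P (ka P x) = _); apply/eqP.
have -> : tau P x = t *: zbase P - Kernel xk.
  by apply: val_inj; rewrite /= tauE kat scalerA.
by rewrite linearB linearZ /= fz kat -scalerA opprB addrC addrNK.
Qed.

Section Lift.
Variables (G Y : omod O) (e : omor G Y) (f : omor K Y).
Variables (zeta : forall P, G P) (d : forall A B, arrow A B -> G A).
Hypothesis e_epi : oepi e.
Hypothesis zetaE : forall P, e P (zeta P) = f P (zbase P).
Hypothesis dE : forall A B (h : arrow A B), e A (d h) = f A (dbase h).

(* [s] is a twisted morphism, not a natural one: it is the first component of a lift of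
   [(v, ka)] to the extension [twist d] of the structure sheaf by [G]. *)
Lemma twist_lift (ka : omor X (structure_sheaf O)) (v : forall P, X P -> Y P) :
  (forall P, linear (v P)) ->
  (forall A B (h : arrow A B) x,
     v A (ores h x) = ores h (v B x) + (ka A (ores h x) : O A) *: e A (d h)) ->
  exists s : forall P, {linear X P -> G P},
     (forall P x, e P (s P x) = v P x) /\
    forall A B (h : arrow A B) x,
     s A (ores h x) = ores h (s B x) + (ka A (ores h x) : O A) *: d h.
Proof.
move=> vl vn; pose ed A B (h : arrow A B) := e A (d h).
have [||q qE] := @mk_omor _ _ (twist d) (twist ed) (fun P x => (e P x.1, x.2)).
- by move=> P a x y; apply: (congr2 pair) => //=; rewrite linearP.
- move=> A B h x; apply: (congr2 pair) => //=.
  by rewrite linearD linearZ /= mor_natural.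
have [||w wE] := @mk_omor _ _ X (twist ed) (fun P x => (v P x, ka P x)).
- by move=> P a x y; apply: (congr2 pair); rewrite ?vl ?linearP.
- move=> A B h x; apply: (congr2 pair) => /=; last by rewrite -(mor_natural ka).
  by rewrite vn -(mor_natural ka).
have [|s sE] := X_proj w (_ : oepi q).
  by move=> P [y a]; have [x xy] := e_epi y; exists (x, a); rewrite qE /= xy.
have sP P x : (e P (s P x).1, (s P x).2) = (v P x, ka P x).
  by rewrite -qE -wE -(omorE sE x).
have s1 P x : e P (s P x).1 = v P x by case: (sP P x).
have s2 P x : (s P x).2 = ka P x by case: (sP P x).
have sl P : linear (fun x => (s P x).1) by move=> a x y; rewrite linearP.
pose s' P : {linear X P -> G P} :=
  HB.pack (fun x => (s P x).1) (GRing.isLinear.Build _ _ _ _ _ (sl P)).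
exists s'.
split=> //= A B h x.
by rewrite -mor_natural /= s2 -(mor_natural ka).
Qed.

(** The relations that prescribed values [zeta] at [zbase] and [d] at [dbase] must obey. The second
    comes from restricting [z B *: base B] to [A] and writing [ores h (base B)] as
    [base A - dbase h]. *)
Hypothesis zeta0 : forall P t, t * z P = 0 -> t *: zeta P = 0.
Hypothesis compat : forall A B (h : arrow A B) w, rres O h (z B) = w * z A ->
  ores h (zeta B) = w *: zeta A - rres O h (z B) *: d h.

(* On [x] with [ka x = t * z] one puts [u x = t *: zeta - s x], where [s] lifts the map
   [x |-> f (ka x *: base - x)] along [e] up to the twist by [d]. *)
Lemma oker_lift : exists2 u : omor K G, ocomp e u = f & exists s : forall P, G P,
  (forall P, u P (zbase P) = zeta P - z P *: s P) /\
  (forall A B (h : arrow A B), u A (dbase h) = d h - (s A - ores h (s B))).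
Proof.
have [ka [tau [kaE taul tauE]]] := tau_exists.
have kan A B (h : arrow A B) x : rres O h (ka B x) = ka A (ores h x).
  by rewrite -(mor_natural ka).
have [||s [es sn]] := @twist_lift ka (fun P x => f P (tau P x)).
- by move=> P a x y; rewrite taul linearP.
- move=> A B h x; rewrite mor_natural dE -linearZ -linearD; congr (f A _).
  apply: val_inj; rewrite /= !tauE raddfB /= ores_semilinear kan scalerBr.
  by rewrite [RHS]addrC addrA subrK.
have kz P (x : K P) : exists t, ka P (ker_val x) = t * z P.
  by apply/pi_ker; rewrite (omorE kaE _ : pi P (ka P _) = _); apply/eqP/kerP.
pose t P x : O P := projT1 (cid (@kz P x)).
have tE P x : ka P (ker_val x) = t P x * z P by rewrite /t; case: cid.
(* The quotient [t] is only chosen, but by [zeta0] the product [t *: zeta] does not depend on the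
   choice; linearity and naturality of [u] rest on this. *)
have tz P (x : K P) a : ka P (ker_val x) = a * z P -> t P x *: zeta P = a *: zeta P.
  move=> xa; apply/eqP; rewrite -subr_eq0 -scalerBl; apply/eqP/zeta0.
  by rewrite mulrBl -tE xa subrr.
have [||u uE] := @mk_omor _ _ K G (fun P x => t P x *: zeta P - s P (ker_val x)).
- move=> P a x y; rewrite /= linearP (tz _ _ (a * t P x + t P y)).
    by rewrite scalerDl -scalerA scalerBr opprD addrACA.
  by rewrite /= linearP /= !tE mulrDl -mulrA.
- move=> A B h x; have [w zw] := res_z h.
  rewrite (tz _ _ (rres O h (t B x) * w)); last first.
    by rewrite /= -kan tE rmorphM /= zw mulrA.
  rewrite raddfB /= ores_semilinear (compat zw) sn -kan tE rmorphM /=.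
  by rewrite scalerBr !scalerA opprD addrA addrAC.
exists u.
  apply: omorP => P x; rewrite /= uE linearB linearZ /= zetaE es.
  rewrite -linearZ -linearB; congr (f P _); apply: val_inj.
  by rewrite /= tauE tE scalerA subKr.
(* Both [ka base] and 1 lift [pi 1], so they differ by a multiple of [z]; the coefficient [b]
   corrects the final change of base. *)
have ka1 P : exists b, ka P (base P) = 1 + b * z P.
  have /pi_ker[b bE] : pi P (ka P (base P) - 1) = 0.
    by rewrite linearB /= (omorE kaE _ : pi P (ka P _) = _) baseE subrr.
  by exists b; rewrite -bE addrC subrK.
pose b P : O P := projT1 (cid (ka1 P)).
have bE P : ka P (base P) = 1 + b P * z P by rewrite /b; case: cid.
exists (fun P => s P (base P) - b P *: zeta P); split=> [P|A B h].
  rewrite uE (tz _ _ (1 + b P * z P)) /=; last first.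
    by rewrite linearZ /= bE [LHS]mulrC.
  rewrite linearZ /= scalerDl scale1r scalerBr opprB scalerA mulrC addrA.
  by rewrite addrAC.
have [w zw] := res_z h.
rewrite uE (tz _ _ (b A - rres O h (b B) * w)) /=; last first.
  rewrite linearB /= bE -kan bE rmorphD rmorph1 rmorphM /= zw.
  by rewrite opprD addrACA subrr add0r mulrBl mulrA.
rewrite linearB /= sn -kan bE rmorphD rmorph1 rmorphM /= !scalerDl scale1r scaleNr.
rewrite (raddfB (ores h)) /= ores_semilinear (compat zw) scalerBr -!scalerA.
rewrite !opprD !opprK !addrA.
by rewrite [LHS](ACl (5*3*1*4*2*6)).
Qed.
End Lift.

(** When [z = 0] every [zbase] vanishes and both relations are trivial, so any preimages of the
    values at [dbase] can be used. *)
Lemma oker_projective_free : (forall P, z P = 0) -> projective K.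
Proof.
move=> z0 G Y e f e_epi.
pose d A B (h : arrow A B) : G A := projT1 (cid (e_epi A (f A (dbase h)))).
have dE A B (h : arrow A B) : e A (d A B h) = f A (dbase h) by rewrite /d; case: cid.
have [|||u ue _] := @oker_lift G Y e f (fun=> 0) d e_epi _ dE; last by exists u.
- move=> P; rewrite linear0 (_ : zbase P = 0) ?linear0 //.
  by apply: val_inj; rewrite /= z0 scale0r.
- by move=> P t _; rewrite scaler0.
- by move=> A B h w _; rewrite raddf0 z0 rmorph0 scale0r scaler0 subrr.
Qed.

Section Unit.
Hypothesis z_reg : forall P t, t * z P = 0 -> t = 0.
Hypothesis z_unit : forall A B (h : arrow A B), exists v, v * rres O h (z B) = 1.

(** Multiplied by the unit [rres O h (z B)], the condition at an arrow follows from the conditions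
    at [zbase]. *)
Lemma oker_extend_unit G (f : omor K G) :
  (forall P, exists n, f P (zbase P) = z P *: n) ->
  exists g : omor X G, ocomp g (oker_incl p) = f.
Proof.
move=> fz; pose n P : G P := projT1 (cid (fz P)).
have nE P : f P (zbase P) = z P *: n P by rewrite /n; case: cid.
apply: (oker_extend nE) => A B h.
have [[w zw] [v vz]] := (res_z h, z_unit h).
rewrite -[LHS]scale1r -[RHS]scale1r -vz -!scalerA; congr (v *: _).
rewrite scalerBr {2}zw -scalerA -ores_semilinear -!nE mor_natural -!linearZ -linearB.
by congr (f A _); apply: val_inj; rewrite /= scalerBr -ores_semilinear zw scalerA.
Qed.

Lemma oker_lift_unit G Y (e : omor G Y) (f : omor K Y) (zeta : forall P, G P) :
  oepi e -> (forall P, e P (zeta P) = f P (zbase P)) ->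
  exists2 u : omor K G, ocomp e u = f &
    forall P, exists s, u P (zbase P) = zeta P - z P *: s.
Proof.
move=> e_epi zetaE.
pose w A B (h : arrow A B) : O A := projT1 (cid (res_z h)).
have wE A B (h : arrow A B) : rres O h (z B) = w A B h * z A by rewrite /w; case: cid.
pose v A B (h : arrow A B) : O A := projT1 (cid (z_unit h)).
have vE A B (h : arrow A B) : v A B h * rres O h (z B) = 1 by rewrite /v; case: cid.
(* This is [compat] solved for [d], possible because the restriction of [z B] is invertible. *)
pose d A B (h : arrow A B) := v A B h *: (w A B h *: zeta A - ores h (zeta B)).
have [|||u ue [s [us _]]] := @oker_lift G Y e f zeta d e_epi zetaE; last 1 first.
- by exists u => // P; exists (s P).
- move=> A B h; rewrite linearZ linearB linearZ /= zetaE -mor_natural zetaE mor_natural.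
  rewrite -!linearZ -linearB -linearZ; congr (f A _); apply: val_inj => /=.
  by rewrite scalerA -wE ores_semilinear -scalerBr scalerA vE scale1r.
- by move=> P t /z_reg ->; rewrite scale0r.
move=> A B h w' w'E; rewrite scalerA [_ * v _ _ _]mulrC vE scale1r.
rewrite (_ : w A B h = w') ?subKr //; apply/eqP; rewrite -subr_eq0.
by apply/eqP/z_reg; rewrite mulrBl -wE w'E subrr.
Qed.

Lemma oker_projective_unit : projective K.
Proof.
move=> G Y e f e_epi; pose zeta P := projT1 (cid (e_epi P (f P (zbase P)))).
have [|u ue _] := @oker_lift_unit G Y e f zeta e_epi; last by exists u.
by move=> P; rewrite /zeta; case: cid.
Qed.
End Unit.
End Syzygy.

(** * Ext groups through morphisms out of syzygies *)

Section Ext.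
Variables (k : fieldType) (O : ring_sheaf k).
Implicit Types F G : omod O.

(** A cocycle vanishes on the image of the next differential, which by exactness is the kernel of
    the augmentation onto the syzygy. *)
Lemma cocycle_factor F G i (f : cocycle F G i) :
  exists f' : omor (syzygy F i) G, ocomp f' (cover_aug (syzygy F i)) = ker_val f.
Proof.
apply: epi_factor; first exact: cover_aug_epi.
move=> P x; have /eqP f0 := kerP f.
case/(free_exact0 (F := F) (n := i)) => y <-.
exact: (omorE f0 y).
Qed.

Lemma factor_cocycle F G i (f' : omor (syzygy F i) G) :
  exists f : cocycle F G i, ker_val f = ocomp f' (cover_aug (syzygy F i)).
Proof.
have fk : ocomp f' (cover_aug (syzygy F i)) \in
    in_ker (@precomp _ _ _ _ G (rdiff (free_resolution F) i)).
  rewrite in_kerE; apply/eqP/omorP => P x.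
  rewrite -[LHS]/(f' P (cover_aug (syzygy F i) P (free_diff F i P x))).
  rewrite (_ : cover_aug (syzygy F i) P _ = 0) ?linear0 //.
  by apply/(free_exact0 (F := F) (n := i)); exists x.
by exists (Kernel fk).
Qed.

(** With [factor_cocycle], this turns positive-degree Ext into morphisms out of a syzygy modulo
    those extending to the cover that contains it. *)
Lemma coboundaryP F G i (f : cocycle F G i.+1) (f' : omor (syzygy F i.+1) G) :
  ocomp f' (cover_aug (syzygy F i.+1)) = ker_val f ->
  (f \in @coboundary _ _ F G i.+1) <->
  (exists g : omor (Defs.cover (syzygy F i)) G, ocomp g (oker_incl (cover_aug (syzygy F i))) = f').
Proof.
move=> ff'; split=> [/asboolP[g gf]|[g gf]]; last first.
  by apply/asboolP; exists g; rewrite -ff' -gf; apply: omorP.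
exists g; apply: omorP => P y.
have [x <-] := @cover_aug_epi _ _ (syzygy F i.+1) P y.
by rewrite -[RHS]/(ocomp f' _ P x) ff' -gf.
Qed.

Lemma ext_class_eq0 F G i (f : cocycle F G i) :
  ext_class f = 0 <-> f \in @coboundary _ _ F G i.
Proof.
by rewrite -(raddf0 (@qclass k _ (@coboundary k O F G i))) qclassP subr0.
Qed.

Lemma ext_class0_eq0 F G (f : cocycle F G 0) : ext_class f = 0 <-> ker_val f = 0.
Proof.
by rewrite ext_class_eq0; split=> [/asboolP ->//|f0]; apply/asboolP/val_inj.
Qed.

(** The cover of a projective syzygy splits, so the next syzygy is a retract of that cover. *)
Lemma syzygy_projective F n : projective (syzygy F 1) -> projective (syzygy F n.+1).
Proof.
move=> pF; elim: n => // n IH.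
have [r rE] := oker_retract IH (@cover_aug_epi _ _ (syzygy F n.+1)).
exact: retract_projective (@cover_projective _ _ _) rE.
Qed.

Lemma Ext_eq0 F G i : projective (syzygy F 1) -> (2 <= i)%N ->
  forall x : Ext F G i, x = 0.
Proof.
move=> pF; case: i => [//|[//|i]] _ x.
have [f ->] := qclass_surj x; have [f' ff'] := cocycle_factor f.
apply/ext_class_eq0/(coboundaryP ff').
(* Composing with this retraction extends every morphism from the syzygy to the cover, so every
   cocycle is a coboundary. *)
have [r rE] := oker_retract (syzygy_projective (n := i) pF) (@cover_aug_epi _ _ (syzygy F i.+1)).
exists (ocomp f' r); apply: omorP => P y.
exact: (congr1 (f' P) (omorE rE y)).
Qed.

(** Every one-dimensional Ext group below is identified with [k] by such a form on cocycles, which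
    keeps classes computable on representatives. *)
Lemma Ext_iso F G i (l : {linear cocycle F G i -> k^o}) :
  (forall f, l f = 0 <-> f \in @coboundary _ _ F G i) -> (exists f, l f = 1) ->
  exists2 L : {linear Ext F G i -> k^o}, bijective L & forall f, L (ext_class f) = l f.
Proof.
move=> lker [f1 lf1].
pose L0 (X : Ext F G i) : k^o := l (projT1 (cid (qclass_surj X))).
have L0E f : L0 (ext_class f) = l f.
  rewrite /L0; case: cid => g /= /esym/qclassP/lker/eqP.
  by rewrite linearB subr_eq0 => /eqP.
have L0l : linear L0.
  move=> a x y; have [f ->] := qclass_surj x; have [g ->] := qclass_surj y.
  rewrite -[_ *: _ + _]linearP /=; rewrite -!/(ext_class _) !L0E.
  exact: linearP.
pose L : {linear Ext F G i -> k^o} := HB.pack L0 (GRing.isLinear.Build _ _ _ _ _ L0l).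
exists L => //; exists (fun c => c *: ext_class f1) => [x|c]; last first.
  by rewrite linearZ /= L0E lf1; exact: mulr1.
have [f ->] := qclass_surj x; rewrite -[qclass _ f]/(ext_class f) /= L0E.
rewrite -[_ *: _]linearZ /=; apply/qclassP/lker.
by rewrite linearB linearZ /= lf1; apply/eqP; rewrite subr_eq0 [_ *: _]mulr1.
Qed.
End Ext.

(** * Laurent polynomials *)

Section Laurent.
Variable k : fieldType.
Local Notation frac := (@FracField.tofrac {poly k}).
Implicit Types (f g : laurent k) (p q : {poly k}).

Lemma coefMXnD p i n : (p * 'X^n)`_(i + n) = p`_i.
Proof. by rewrite coefMXn ltnNge leq_addl addnK. Qed.

Lemma laurent_fracP f : exists n p, laurent_val f * frac 'X ^+ n = frac p.
Proof. exact/asboolP/laurentP. Qed.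

Lemma lX_poly_eval n : poly_eval (lX k (- 1)) 'X^n = lX k (- n%:Z).
Proof.
rewrite rmorphXn /= /poly_eval horner_algX; elim: n => [|n IH].
  by rewrite expr0 oppr0 lX0.
by rewrite exprS IH -lXD intS opprD.
Qed.

(** The hypothesis on [u] forces its inverse [w] to be the monomial of exponent [- a], which settles
    negative [n]. *)
Lemma laurent_eval_int (u w : laurent k) (uw : u * w = 1) a :
  u = lX k a -> forall n, laurent_eval uw (lX k n) = lX k (a * n).
Proof.
move=> ua; have wa : w = lX k (- a).
  by rewrite -[w]mul1r -(lXNV k a) -mulrA -ua uw mulr1.
case=> n.
  rewrite (_ : lX k n = lX k 1 ^+ n); last first.
    elim: n => [|n IH]; first by rewrite expr0 lX0.
    by rewrite intS lXD IH exprS.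
  rewrite rmorphXn /= laurent_eval_lX ua; elim: n => [|n IH].
    by rewrite expr0 mulr0 lX0.
  by rewrite exprS IH intS mulrDr mulr1 lXD.
rewrite (@laurent_evalE _ _ _ _ _ _ n.+1 1).
  rewrite rmorph1 mul1r wa NegzE; elim: n.+1 => [|m IH].
    by rewrite expr0 oppr0 mulr0 lX0.
  by rewrite exprS IH intS opprD mulrDr mulrN1 lXD.
rewrite tofrac1 /= mulVf //; apply: expf_neq0; exact: tofracX_neq0.
Qed.

Lemma laurent_sum f : exists N p, f = \sum_(i < size p) p`_i *: lX k (i%:Z - N%:Z).
Proof.
have [N [p fp]] := laurent_fracP f; exists N, p; apply: val_inj.
have XN : frac 'X ^+ N != 0 :> {fraction {poly k}} by apply/expf_neq0/tofracX_neq0.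
apply: (mulIf XN); rewrite [LHS]fp -[in LHS](coefK p) poly_def.
rewrite [frac _]rmorph_sum [\val _]raddf_sum mulr_suml.
apply: eq_bigr => i _; rewrite -mul_polyC /= rmorphM /= rmorphXn /=.
rewrite -mulrA; congr (_ * _); rewrite !exprnP -expfzDr ?tofracX_neq0 //.
by rewrite subrK.
Qed.

Lemma laurent_ind (P : laurent k -> Prop) : P 0 ->
  (forall c n f, P f -> P (c *: lX k n + f)) -> forall f, P f.
Proof.
move=> P0 PD f; have [N [p ->]] := laurent_sum f.
by apply: big_rec => // i x _ Px; apply: PD.
Qed.

Section Coef.
Variable m : nat.

(** The coefficient of [X ^ m]: in a fraction [p / X ^ n] it sits at index [m + n] of the numerator.
    [lcoefE] shows that the chosen fraction does not matter. *)
Definition lcoef f : k^o :=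
  let: exist n fn := cid (laurent_fracP f) in let: exist p _ := cid fn in p`_(m + n).

Lemma lcoefE f n p : laurent_val f * frac 'X ^+ n = frac p -> lcoef f = p`_(m + n).
Proof.
rewrite /lcoef; case: cid => n' fn; case: cid => q fq fp.
have e : p * 'X^n' = q * 'X^n.
  apply/eqP; rewrite -tofrac_eq !tofracM !tofracXn -fq -fp.
  by rewrite -!mulrA [_ ^+ n * _]mulrC.
have := congr1 (fun s : {poly k} => s`_(m + n + n')) e.
by rewrite coefMXnD addnAC coefMXnD => ->.
Qed.

Lemma lcoef_linear : linear lcoef.
Proof.
move=> c f g; have [n [p fp]] := laurent_fracP f; have [n' [q gq]] := laurent_fracP g.
rewrite (lcoefE fp) (lcoefE gq) (@lcoefE _ (n + n') (c *: (p * 'X^n') + q * 'X^n)).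
  by rewrite coefD coefZ addnA coefMXnD addnAC coefMXnD.
rewrite /= mulrDl -mul_polyC rmorphD !rmorphM !rmorphXn /= -fp -gq exprD.
by rewrite !mulrA; congr (_ + _); rewrite mulrAC.
Qed.
HB.instance Definition _ := GRing.isLinear.Build k (laurent k) k^o *:%R lcoef lcoef_linear.

Lemma lcoef_lX n : lcoef (lX k n) = (n == m%:Z)%:R.
Proof.
case: n => n.
  rewrite (@lcoefE _ 0 'X^n) ?addn0 ?coefXn 1?eq_sym //.
  by rewrite mulr1 rmorphXn.
rewrite (@lcoefE _ n.+1 1) ?coef1 ?addnS //.
rewrite tofrac1 /= mulVf //; apply: expf_neq0; exact: tofracX_neq0.
Qed.
End Coef.
End Laurent.

(** * Cohomology of omega *)

Section Restrictions.
Variables (k : fieldType) (O : ring_sheaf k) (F : omod O).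
Variables (A B C : obj) (h : arrow A B) (h' : arrow A C).

Lemma ores_subD (m n : F B) (m' n' : F C) :
  ores h (m + n) - ores h' (m' + n') =
  (ores h m - ores h' m') + (ores h n - ores h' n').
Proof. by rewrite !raddfD /= addrACA. Qed.

Lemma ores_subr0 (m : F B) : ores h m - ores h' 0 = ores h m.
Proof. by rewrite raddf0 subr0. Qed.

Lemma ores_sub0r (m : F C) : ores h 0 - ores h' m = - ores h' m.
Proof. by rewrite raddf0 sub0r. Qed.

Lemma ores_sub00 : ores h (0 : F B) - ores h' (0 : F C) = 0.
Proof. by rewrite ores_subr0 raddf0. Qed.

Lemma ores_subZ (c : k) (m : F B) (m' : F C) :
  ores h (c%:A *: m) - ores h' (c%:A *: m') = (c%:A : O A) *: (ores h m - ores h' m').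
Proof. by rewrite !ores_semilinear !rmorph_alg scalerBr. Qed.
End Restrictions.

Section PolyEvalCoef.
Variable k : fieldType.

Lemma poly_eval_sum (p : {poly k}) :
  poly_eval (lX k (- 1)) p = \sum_(i < size p) p`_i *: lX k (- i%:Z).
Proof.
rewrite -[in LHS](coefK p) poly_def raddf_sum; apply: eq_bigr => i _.
by rewrite /= linearZ /= lX_poly_eval.
Qed.

(** All exponents of [p(1/X) X^d] are at most [d], and [d] itself is reached only by the constant
    term of [p]. *)
Lemma lcoef_poly_eval (m : nat) (d : int) (p : {poly k}) : d <= m%:Z ->
  lcoef m (poly_eval (lX k (- 1)) p * lX k d) = if d == m%:Z then p`_0 else 0.
Proof.
move=> dm; rewrite poly_eval_sum mulr_suml raddf_sum /=.
under eq_bigr => i _ do rewrite -scalerAl -lXD linearZ /= lcoef_lX.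
case: (eqVneq d m%:Z) dm => [-> _|nd dm]; last first.
  rewrite big1 // => i _; rewrite (_ : _ == _ = false) ?scaler0 //; lia.
case: (posnP (size p)) => [p0|p_gt0].
  by move/eqP: p0; rewrite size_poly_eq0 => /eqP->; rewrite size_poly0 big_ord0 coef0.
rewrite (bigD1 (Ordinal p_gt0)) //= oppr0 add0r eqxx [_ *: _]mulr1 big1 ?addr0 //.
move=> i; rewrite -val_eqE /= => i0; rewrite (_ : _ == _ = false) ?scaler0 //; lia.
Qed.

Lemma lcoefB m (f g : laurent k) : lcoef m (f - g) = lcoef m f - lcoef m g.
Proof. exact: linearB. Qed.

Lemma lcoef_sum m n (f : 'I_n -> laurent k) :
  lcoef m (\sum_i f i) = \sum_i lcoef m (f i).
Proof. exact: linear_sum. Qed.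

Lemma lcoef_mul_ext m (g : laurent k) (e1 e2 : {linear laurent k -> laurent k})
    (a1 a2 : int -> int) :
  (forall n, e1 (lX k n) = lX k (a1 n)) -> (forall n, e2 (lX k n) = lX k (a2 n)) ->
  (forall n, lcoef m (lX k (a1 n) * g) = lcoef m (lX k (a2 n) * g)) ->
  forall f, lcoef m (e1 f * g) = lcoef m (e2 f * g).
Proof.
move=> e1X e2X e12; elim/laurent_ind => [|c n f IH]; first by rewrite !linear0 mul0r.
by rewrite !(linearD, linearZ, mulrDl) -!scalerAl !linearZ /= e1X e2X e12 IH.
Qed.

End PolyEvalCoef.

(** * Cech boundaries of omega and the residue *)

Section Omega.
Variables (k : fieldType) (r : nat).
Hypothesis r_gt0 : (0 < r)%N.
Local Notation O := (Okr k r).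
Local Notation omega := (omega_kr k r).

(* Once the monomials of A1 and A2 are identified through B3, x^(r-1) is the only one that
   comes neither from B1 nor from B2. *)
Definition residue (a1 a2 : laurent k) : k^o := lcoef r.-1 a1 - lcoef r.-1 a2.

Lemma residueD a1 a2 b1 b2 : residue (a1 + b1) (a2 + b2) = residue a1 a2 + residue b1 b2.
Proof. by rewrite /residue !raddfD addrACA. Qed.

Lemma residueZ c a1 a2 : residue (c *: a1) (c *: a2) = c * residue a1 a2.
Proof. by rewrite /residue !linearZ /= -scalerDr. Qed.

Lemma residueB0 x1 x2 y1 y2 : lcoef r.-1 x1 = 0 -> lcoef r.-1 x2 = 0 ->
  lcoef r.-1 y1 = lcoef r.-1 y2 -> residue (x1 - y1) (x2 - y2) = 0.
Proof. by rewrite /residue !lcoefB => -> -> ->; rewrite !sub0r subrr. Qed.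

(** The image of the Cech differential, whose cokernel is H^1. *)
Definition is_bdry (a1 a2 : laurent k) := exists m1 m2 m3,
  a1 = ores (o := omega) A1B1 m1 - ores (o := omega) A1B3 m3 /\
  a2 = ores (o := omega) A2B2 m2 - ores (o := omega) A2B3 m3.

(** Uniqueness of Euclidean division by [r]: quotient 0 and remainder [r - 1]. *)
Lemma eq_top_exponent (n : int) (j : nat) : (j < r)%N ->
  (r%:Z * n + j%:Z == r.-1%:Z) = (n == 0) && (j == r.-1).
Proof.
move=> jr; have [n0|n0|->] := ltrgtP n 0; last by rewrite mulr0 add0r.
  have : r%:Z * n <= r%:Z * (- 1) by rewrite ler_pM2l; lia.
  lia.
have : r%:Z * 1 <= r%:Z * n by rewrite ler_pM2l; lia.
lia.
Qed.

Lemma res_A1B3_lX n : rres O A1B3 (lX k n) = lX k (r%:Z * n).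
Proof. exact: laurent_eval_int. Qed.

Lemma res_A2B3_lX n : rres O A2B3 (lX k n) = lX k (- r%:Z * n).
Proof. exact: laurent_eval_int. Qed.

(** For [f = v^n] the two exponents are [r n + j] and [- r n + j]; each equals [r - 1] exactly when
    [n = 0] and [j = r - 1]. *)
Lemma lcoef_B3 (f : laurent k) (j : 'I_r) :
  lcoef r.-1 (rres O A1B3 f * lX k j) = lcoef r.-1 (rres O A2B3 f * lX k j).
Proof.
apply: (lcoef_mul_ext (e1 := rres O A1B3) (e2 := rres O A2B3) res_A1B3_lX res_A2B3_lX) => n.
rewrite -!lXD !lcoef_lX mulNr -mulrN.
by rewrite !eq_top_exponent // oppr_eq0.
Qed.

Lemma lcoef_omega_B1 (m : omega B1) : lcoef r.-1 (ores (o := omega) A1B1 m) = 0.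
Proof.
have r2 : r%:Z - 2 <= r.-1%:Z by lia.
by apply: etrans (lcoef_poly_eval m r2) _; case: eqP => //; lia.
Qed.

Lemma lcoef_omega_B2 (m : omega B2) : lcoef r.-1 (ores (o := omega) A2B2 m) = 0.
Proof.
have r2 : r%:Z - 2 <= r.-1%:Z by lia.
by apply: etrans (lcoef_poly_eval m r2) _; case: eqP => //; lia.
Qed.

Lemma lcoef_omega_B3 (m : omega B3) :
  lcoef r.-1 (ores (o := omega) A1B3 m) = lcoef r.-1 (ores (o := omega) A2B3 m).
Proof.
apply: etrans (lcoef_sum _ _) (etrans _ (esym (lcoef_sum _ _))).
by apply: eq_bigr => j _; apply: lcoef_B3.
Qed.

Lemma residue_bdry a1 a2 : is_bdry a1 a2 -> residue a1 a2 = 0.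
Proof.
case=> m1 [m2 [m3 [-> ->]]]; apply: residueB0 (lcoef_omega_B3 _).
  exact: lcoef_omega_B1.
exact: lcoef_omega_B2.
Qed.

Lemma bdryD a1 a2 b1 b2 : is_bdry a1 a2 -> is_bdry b1 b2 -> is_bdry (a1 + b1) (a2 + b2).
Proof.
move=> [m1 [m2 [m3 [-> ->]]]] [n1 [n2 [n3 [-> ->]]]].
exists (m1 + n1), (m2 + n2), (m3 + n3).
split; first exact: esym (ores_subD (F := omega) A1B1 A1B3 m1 n1 m3 n3).
exact: esym (ores_subD (F := omega) A2B2 A2B3 m2 n2 m3 n3).
Qed.

Lemma bdryZ (c : k) a1 a2 : is_bdry a1 a2 -> is_bdry (c *: a1) (c *: a2).
Proof.
move=> [m1 [m2 [m3 [-> ->]]]].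
exists (c%:A *: m1), (c%:A *: m2), (c%:A *: m3).
split; apply: etrans (esym (mulr_algl _ _)) _.
  exact: esym (ores_subZ (F := omega) A1B1 A1B3 c m1 m3).
exact: esym (ores_subZ (F := omega) A2B2 A2B3 c m2 m3).
Qed.

Lemma bdry0 : is_bdry 0 0.
Proof.
exists 0, 0, 0; split; first exact: esym (ores_sub00 omega A1B1 A1B3).
exact: esym (ores_sub00 omega A2B2 A2B3).
Qed.

(** The monomial [y^i] restricts to [x^(r-2-i)], which covers every exponent up to [r - 2]. *)
Lemma lX_B1 (n : int) : n <= r%:Z - 2 ->
  exists p, poly_eval (lX k (- 1)) p * lX k (r%:Z - 2) = lX k n.
Proof.
move=> nr; have [i iE] : exists i : nat, r%:Z - 2 - n = i by exists (absz (r%:Z - 2 - n)%R); lia.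
by exists 'X^i; rewrite lX_poly_eval -lXD; congr lX; lia.
Qed.

Lemma bdry_B1 (n : int) : n <= r%:Z - 2 -> is_bdry (lX k n) 0.
Proof.
case/lX_B1 => p pE; exists p, 0, 0; split.
  by apply: etrans (esym pE) (esym (ores_subr0 (F := omega) A1B1 A1B3 p)).
exact: esym (ores_sub00 omega A2B2 A2B3).
Qed.

Lemma bdry_B2 (n : int) : n <= r%:Z - 2 -> is_bdry 0 (lX k n).
Proof.
case/lX_B1 => p pE; exists 0, p, 0; split.
  exact: esym (ores_sub00 omega A1B1 A1B3).
by apply: etrans (esym pE) (esym (ores_subr0 (F := omega) A2B2 A2B3 p)).
Qed.

Lemma sum_delta_row (e : {linear laurent k -> laurent k}) (f : laurent k) (i : 'I_r) :
  \sum_(j < r) e ((\row_j (if j == i then f else 0)) 0 j) * lX k j = e f * lX k i.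
Proof.
rewrite (bigD1 i) //= mxE eqxx big1 ?addr0 // => j ji.
by rewrite mxE (negbTE ji) linear0 mul0r.
Qed.

Lemma bdry_B3 (n : int) (j : nat) : (j < r)%N ->
  is_bdry (lX k (r%:Z * n + j%:Z)) (lX k (- r%:Z * n + j%:Z)).
Proof.
move=> jr; pose m : omega B3 := \row_i (if i == Ordinal jr then lX k n else 0).
have m1 : ores (o := omega) A1B3 m = lX k (r%:Z * n + j%:Z).
  apply: etrans (sum_delta_row (rres O A1B3) (lX k n) (Ordinal jr)) _.
  by rewrite lXD; congr (_ * _); apply: res_A1B3_lX.
have m2 : ores (o := omega) A2B3 m = lX k (- r%:Z * n + j%:Z).
  apply: etrans (sum_delta_row (rres O A2B3) (lX k n) (Ordinal jr)) _.
  by rewrite lXD; congr (_ * _); apply: res_A2B3_lX.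
(* The differential subtracts the contribution of B3, hence the signs, removed by scaling with
   -1. *)
have m3 : is_bdry (- lX k (r%:Z * n + j%:Z)) (- lX k (- r%:Z * n + j%:Z)).
  rewrite -m1 -m2; exists 0, 0, m; split.
    exact: esym (ores_sub0r (F := omega) A1B1 A1B3 m).
  exact: esym (ores_sub0r (F := omega) A2B2 A2B3 m).
by have := bdryZ (- 1) m3; rewrite !scaleN1r !opprK.
Qed.

(** Removing the [X ^ m] term leaves a combination of the other monomials, so a linear property need
    only be checked on those. *)
Lemma laurent_ind_coef (m : nat) (P : laurent k -> Prop) : P 0 ->
  (forall c a, P a -> P (c *: a)) -> (forall a b, P a -> P b -> P (a + b)) ->
  (forall n, n != m%:Z -> P (lX k n)) ->
  forall a, P (a - (lcoef m a : k) *: lX k m%:Z).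
Proof.
move=> P0 PZ PD PX; elim/laurent_ind => [|c n a IH].
  by rewrite raddf0 scale0r subr0.
have -> : lcoef m (c *: lX k n + a) = c * lcoef m (lX k n) + lcoef m a.
  exact: linearP.
rewrite scalerDl opprD addrACA -scalerA -scalerBr; apply: PD => //; apply: PZ.
rewrite lcoef_lX; have [->|/PX] := eqVneq n m%:Z; first by rewrite scale1r subrr.
by rewrite scale0r subr0.
Qed.

(** An exponent [n >= r] is written [r q + j] with [q >= 1]. Through B3 its monomial is traded for
    one on A2 of exponent [- r q + j <= -1 <= r - 2], which comes from B2. *)
Lemma bdry_A1_lX (n : int) : n != r.-1%:Z -> is_bdry (lX k n) 0.
Proof.
move=> nr; have [|nr2] := lerP n (r%:Z - 2); first exact: bdry_B1.
have [i iE ir] : exists2 i : nat, n = i & (r <= i)%N by exists (absz n); lia.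
have oth : - r%:Z * (i %/ r)%N%:Z + (i %% r)%N%:Z <= r%:Z - 2.
  have : (0 < i %/ r)%N by rewrite divn_gt0.
  have := ltn_pmod i r_gt0; nia.
have := bdryD (bdry_B3 (i %/ r)%N%:Z (ltn_pmod i r_gt0)) (bdryZ (- 1) (bdry_B2 oth)).
rewrite scaler0 scaleN1r subrr addr0 (_ : r%:Z * (i %/ r)%N%:Z + (i %% r)%N%:Z = n) //.
rewrite iE [in RHS](divn_eq i r); lia.
Qed.

Lemma bdry_A1 (a : laurent k) :
  is_bdry (a - (lcoef r.-1 a : k) *: lX k r.-1%:Z) 0.
Proof.
apply: (laurent_ind_coef (P := fun a => is_bdry a 0)) bdry_A1_lX a; first exact: bdry0.
  by move=> c a /(bdryZ c); rewrite scaler0.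
by move=> a b /bdryD ab /ab; rewrite addr0.
Qed.

(** The same exchange from A2 to A1, with [v] raised to the power [- q]. *)
Lemma bdry_A2_lX (n : int) : n != r.-1%:Z -> is_bdry 0 (lX k n).
Proof.
move=> nr; have [|nr2] := lerP n (r%:Z - 2); first exact: bdry_B2.
have [i iE ir] : exists2 i : nat, n = i & (r <= i)%N by exists (absz n); lia.
have oth : r%:Z * (- (i %/ r)%N%:Z) + (i %% r)%N%:Z <= r%:Z - 2.
  have : (0 < i %/ r)%N by rewrite divn_gt0.
  have := ltn_pmod i r_gt0; nia.
have := bdryD (bdry_B3 (- (i %/ r)%N%:Z) (ltn_pmod i r_gt0)) (bdryZ (- 1) (bdry_B1 oth)).
rewrite scaler0 scaleN1r subrr addr0 (_ : - r%:Z * (- (i %/ r)%N%:Z) + (i %% r)%N%:Z = n) //.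
rewrite iE [in RHS](divn_eq i r); lia.
Qed.

Lemma bdry_A2 (a : laurent k) :
  is_bdry 0 (a - (lcoef r.-1 a : k) *: lX k r.-1%:Z).
Proof.
apply: (laurent_ind_coef (P := fun a => is_bdry 0 a)) bdry_A2_lX a; first exact: bdry0.
  by move=> c a /(bdryZ c); rewrite scaler0.
by move=> a b /bdryD ab /ab; rewrite addr0.
Qed.

Lemma bdryP a1 a2 : is_bdry a1 a2 <-> residue a1 a2 = 0.
Proof.
split=> [|/eqP]; first exact: residue_bdry.
rewrite subr_eq0 => /eqP a12.
(* The last basis vector at B3 restricts to [x^(r-1)] on both sides, so the equal leading terms left
   by [bdry_A1] and [bdry_A2] cancel together. *)
have rr : is_bdry (lX k r.-1%:Z) (lX k r.-1%:Z).
  by have := @bdry_B3 0 r.-1; rewrite !mulr0 !add0r; apply; lia.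
have := bdryD (bdryD (bdry_A1 a1) (bdry_A2 a2)) (bdryZ (lcoef r.-1 a1) rr).
by rewrite addr0 add0r {3}a12 !subrK.
Qed.
End Omega.

(** * The Cech description of H^1 *)

Section Cech.
Variables (k : fieldType) (O : ring_sheaf k).
Local Notation S := (structure_sheaf O).
Local Notation K := (syzygy S 1).

Definition obase P : Defs.cover S P := projT1 (cid (@cover_aug_epi _ _ S P 1)).

Lemma obaseE P : cover_aug S P (obase P) = oid S P 1.
Proof. by rewrite /obase; case: cid. Qed.

Lemma cech_ker A B C (h : arrow A B) (h' : arrow A C) :
  ores h (obase B) - ores h' (obase C) \in in_ker (cover_aug S A).
Proof.
rewrite in_kerE raddfB -[_ (ores h _)](mor_natural (cover_aug S)).
rewrite -[_ (ores h' _)](mor_natural (cover_aug S)) !obaseE /=.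
by rewrite !rmorph1 subrr.
Qed.

(** Evaluating a morphism [K -> G] here gives the component at [A] of its Cech cocycle; unlike
    [dbase], no base element at [A] enters. *)
Definition cech A B C (h : arrow A B) (h' : arrow A C) : K A := Kernel (cech_ker h h').

Lemma oid_ker P a : oid S P a = 0 <-> exists t : O P, a = t * 0.
Proof.
rewrite /=; split=> [->|[t ->]]; last by rewrite mulr0.
by exists 0; rewrite mulr0.
Qed.

Lemma oid_epi : oepi (oid S).
Proof. by move=> P y; exists y. Qed.

Lemma cechE A B C (h : arrow A B) (h' : arrow A C) :
  cech h h' = dbase obaseE h' - dbase obaseE h.
Proof. by apply: val_inj; rewrite /= opprB [RHS]addrC addrA subrK. Qed.

Lemma structure_syzygy_projective : projective K.
Proof.
exact: (oker_projective_free (@cover_projective _ _ S) oid_epi oid_ker obaseE (fun=> erefl)).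
Qed.

Lemma cech_extend G (f : omor K G) :
  (exists g : omor (Defs.cover S) G, ocomp g (oker_incl (cover_aug S)) = f) <->
  (exists m1 m2 m3, f A1 (cech A1B1 A1B3) = ores A1B1 m1 - ores A1B3 m3 /\
                    f A2 (cech A2B2 A2B3) = ores A2B2 m2 - ores A2B3 m3).
Proof.
split=> [[g <-]|[m1 [m2 [m3 [f1 f2]]]]].
  exists (g B1 (obase B1)), (g B2 (obase B2)), (g B3 (obase B3)).
  by rewrite /= !raddfB /= !mor_natural.
(* The values at A1 and A2 are free: they are set so that the conditions along [A1B1] and [A2B2]
   hold, and those along [A1B3] and [A2B3] become the hypothesis. *)
pose n P : G P := match P with
  | B1 => m1 | B2 => m2 | B3 => m3
  | A1 => f A1 (dbase obaseE A1B1) + ores A1B1 m1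
  | A2 => f A2 (dbase obaseE A2B2) + ores A2B2 m2 end.
apply: (oker_extend (@cover_projective _ _ S) oid_epi (pi_ker := oid_ker) (baseE := obaseE) (n := n)) => [P|A B h].
  by rewrite scale0r (_ : zbase _ _ _ = 0) ?linear0 //; apply: val_inj; rewrite /= scale0r.
case: h => /=; rewrite ?addrK //.
  by rewrite -addrA -f1 cechE raddfB /= addrC subrK.
by rewrite -addrA -f2 cechE raddfB /= addrC subrK.
Qed.

Lemma cech_surj (G : omod O) (a1 : G A1) (a2 : G A2) :
  exists (f : omor K G) m1 m2 m3,
    f A1 (cech A1B1 A1B3) = a1 + (ores A1B1 m1 - ores A1B3 m3) /\
    f A2 (cech A2B2 A2B3) = a2 + (ores A2B2 m2 - ores A2B3 m3).
Proof.
pose d A B (h : arrow A B) : G A := match h in arrow A B return G A with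
  | A1B1 | A2B2 => 0 | A1B3 => a1 | A2B3 => a2 end.
(* Lifting the zero morphism along [G -> 0] leaves [d] arbitrary; [oker_lift] realises it up to the
   boundary of [s]. *)
have [|||||f _ [s [_ fd]]] := @oker_lift _ _ _ _ _ (oid S) (fun=> 0) obase
   (@cover_projective _ _ S) oid_epi oid_ker obaseE G (ozero O) 0 0 (fun=> 0) d.
- by move=> P y; exists 0; apply/matrixP => i [].
- by [].
- by [].
- by move=> P t _; rewrite scaler0.
- by move=> A B h w _; rewrite raddf0 rmorph0 scale0r scaler0 subrr.
exists f, (- s B1), (- s B2), (- s B3).
rewrite !cechE !raddfB /= !fd /= !raddfN /=.
by split; rewrite !sub0r !opprK opprB -addrA; congr (_ + _); rewrite addrA subrK addrC.
Qed.
End Cech.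
Arguments obase {k O} P.
Arguments obaseE {k O} P.
Arguments cech {k O A B C} h h'.

(** * The residue isomorphism from H^1(omega) to k *)

Section CohOmega.
Variables (k : fieldType) (r : nat).
Hypothesis r_gt0 : (0 < r)%N.
Local Notation O := (Okr k r).
Local Notation omega := (omega_kr k r).
Local Notation S := (structure_sheaf O).

Lemma residue_alg_linear c (x1 y1 x2 y2 : laurent k) :
  residue r (c%:A * x1 + y1) (c%:A * x2 + y2) = c * residue r x1 x2 + residue r y1 y2.
Proof. by rewrite residueD !mulr_algl residueZ. Qed.

Lemma coh_omega : exists2 phi : {linear coh omega 1 -> k^o}, bijective phi &
  forall (f : cocycle S omega 1) f', ocomp f' (cover_aug (syzygy S 1)) = ker_val f ->
  phi (ext_class f) = residue r (f' A1 (cech A1B1 A1B3)) (f' A2 (cech A2B2 A2B3)).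
Proof.
(* Fixed lifts of the Cech elements to the cover let the residue be read on the cocycle itself, so
   that [l] is visibly linear. *)
have [D1 D1E] := @cover_aug_epi _ _ (syzygy S 1) A1 (cech A1B1 A1B3).
have [D2 D2E] := @cover_aug_epi _ _ (syzygy S 1) A2 (cech A2B2 A2B3).
pose l (f : cocycle S omega 1) : k^o := residue r (ker_val f A1 D1) (ker_val f A2 D2).
have lE (f : cocycle S omega 1) f' : ocomp f' (cover_aug (syzygy S 1)) = ker_val f ->
    l f = residue r (f' A1 (cech A1B1 A1B3)) (f' A2 (cech A2B2 A2B3)).
  by move=> ff'; rewrite /l -ff' -D1E -D2E.
have ll : linear l.
  move=> c f g.
  exact (residue_alg_linear c (ker_val f A1 D1) (ker_val g A1 D1) (ker_val f A2 D2) (ker_val g A2 D2)).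
pose l' : {linear cocycle S omega 1 -> k^o} := HB.pack l (GRing.isLinear.Build _ _ _ _ _ ll).
have [||phi phi_bij phiE] := Ext_iso (l := l').
- move=> f; have [f' ff'] := cocycle_factor f.
  rewrite (coboundaryP ff') cech_extend [l' f](lE _ _ ff').
  by rewrite -bdryP.
- have [f' [m1 [m2 [m3 [f1 f2]]]]] := @cech_surj _ _ omega (lX k r.-1%:Z) 0.
  have [f fE] := factor_cocycle f'; exists f.
  rewrite [l' f](lE _ _ (esym fE)) f1 f2.
  apply: etrans (residueD _ _ _ _ _) _.
  rewrite [X in _ + X](_ : _ = 0).
    by rewrite addr0 /residue lcoef_lX raddf0 eqxx subr0.
  by apply/bdryP => //; exists m1, m2, m3.
by exists phi => // f f' ff'; rewrite phiE; apply: lE.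
Qed.
End CohOmega.

(** * Duality for the skyscrapers *)

Section Duality.
Variables (k : fieldType) (O : ring_sheaf k).

(** Through [a] and [b] both spaces are lines, and the pairing is multiplication in [k] scaled by a
    unit. *)
Lemma perfect_mul (V W : lmodType k) (a : {linear V -> k^o}) (b : {linear W -> k^o}) (c : k) :
  bijective a -> bijective b -> c != 0 -> perfect (fun v w => c * a v * b w).
Proof.
move=> [a' aK a'K] [b' bK b'K] c0; split=> [v d x y|w d x y|l|l].
- by rewrite linearP mulrDr -[RHS]/(d * _ + _) [in RHS]mulrCA.
- rewrite linearP -[RHS]/(d * _ + _) -[d *: a x]/(d * a x) mulrDr mulrDl mulrCA.
  by rewrite -!mulrA.
- exists (a' (l (b' 1) / c)); split=> [w|v vl].
    rewrite a'K mulrCA mulfV // mulr1.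
    have {2}-> : w = b w *: b' 1.
      by apply: (can_inj bK); rewrite linearZ /= b'K [RHS]mulr1.
    by rewrite linearZ [RHS]mulrC.
  apply: (can_inj aK); rewrite a'K -(vl (b' 1)) b'K mulr1 [c * _]mulrC mulfK //.
exists (b' (l (a' 1) / c)); split=> [v|w wl].
  rewrite b'K [c * _]mulrC mulrACA mulfV // mulr1.
  have {2}-> : v = a v *: a' 1.
    by apply: (can_inj aK); rewrite linearZ /= a'K [RHS]mulr1.
  by rewrite linearZ.
by apply: (can_inj bK); rewrite b'K -(wl (a' 1)) a'K mulr1 mulrC mulKf.
Qed.

Lemma perfect_zero (V W : lmodType k) : (forall v : V, v = 0) -> (forall w : W, w = 0) ->
  perfect (fun (_ : V) (_ : W) => 0 : k).
Proof.
move=> V0 W0; split=> [v d x y|w d x y|l|l].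
- by rewrite scaler0 addr0.
- by rewrite scaler0 addr0.
- by exists 0; split=> [w|v _]; [rewrite [w]W0 linear0|rewrite [v]V0].
by exists 0; split=> [v|w _]; [rewrite [v]V0 linear0|rewrite [w]W0].
Qed.

Variables (omega F : omod O).
Local Notation S := (structure_sheaf O).

(** Reduces duality to one product formula for a convenient [phi0]. As H^1(omega) is a line, an
    arbitrary [phi] only rescales the pairing, by [phi x1]; the other pairing is between zero
    spaces. *)
Lemma strong_duality_of (phi phi0 : {linear coh omega 1 -> k^o})
    (al : {linear coh F 0 -> k^o}) (ga : {linear Ext F omega 1 -> k^o}) (e : k) :
  bijective phi -> bijective phi0 -> bijective al -> bijective ga -> e != 0 ->
  (forall (f : cocycle S F 0) (g : cocycle F omega 1) t (ft : is_lift f t),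
     phi0 (ext_class (yoneda_cocycle g ft)) = e * al (ext_class f) * ga (ext_class g)) ->
  (forall x : coh F 1, x = 0) -> (forall x : Ext F omega 0, x = 0) ->
  projective (syzygy F 1) -> strong_duality phi F.
Proof.
move=> [phi' phiK phi'K] [phi0' phi0K phi0'K] al_bij ga_bij e0 yon coh0 ext0 Fp.
pose x1 := phi0' 1.
have phi_x1 : phi x1 != 0.
  apply/eqP => /(congr1 phi'); rewrite phiK => /(congr1 phi0).
  rewrite -[phi' 0](_ : 0 = _); last by apply: (can_inj phiK); rewrite phi'K linear0.
  by rewrite phi0'K linear0 => /eqP; rewrite oner_eq0.
split; last 2 first.
- by move=> i i2; apply: Ext_eq0 i2; apply: structure_syzygy_projective.
- by move=> i i2; apply: Ext_eq0 i2.
- exists (fun x y => (e * al x * ga y) *: x1); split.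
    move=> f g t ft; apply: (can_inj phi0K).
    by rewrite yon linearZ /= phi0'K [LHS]mulr1.
  have -> : (fun x y => phi ((e * al x * ga y) *: x1)) =
            (fun x y => (phi x1 * e) * al x * ga y).
    apply/funext => x; apply/funext => y; rewrite linearZ /=.
    by rewrite [LHS]mulrC !mulrA.
  by apply: perfect_mul => //; rewrite mulf_neq0.
exists (fun _ _ => 0); split.
  move=> f g t ft.
  have /ext_class0_eq0 g0 := ext0 (ext_class g).
  apply/esym/ext_class_eq0.
  have -> : yoneda_cocycle g ft = 0.
    apply: val_inj.
    rewrite [LHS](_ : _ = ocomp (ker_val g) (t 0)) // g0.
    exact: omorP.
  exact: rpred0.
have -> : (fun (x : coh F 1) (y : Ext F omega 0) => phi 0) = (fun _ _ => 0).
  by apply/funext => x; apply/funext => y; rewrite linear0.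
exact: perfect_zero.
Qed.

(** The product is represented by [g] composed with [t 1]. Since [t] commutes with the
    differentials, [t 1] sends a lift of the Cech element over its image under [t 0], which is
    [x]. *)
Lemma yoneda_cech (f : cocycle S F 0) (g : cocycle F omega 1) t (ft : is_lift f t)
    (g' : omor (syzygy F 1) omega) (h : omor (syzygy S 1) omega) A B C
    (u : arrow A B) (v : arrow A C) (x : syzygy F 1 A) :
  ocomp g' (cover_aug (syzygy F 1)) = ker_val g ->
  ocomp h (cover_aug (syzygy S 1)) = ker_val (yoneda_cocycle g ft) ->
  ker_val x = ores u (t 0 B (obase B)) - ores v (t 0 C (obase C)) ->
  h A (cech u v) = g' A x.
Proof.
move=> gE hE xE.
have [D DE] := @cover_aug_epi _ _ (syzygy S 1) A (cech u v).
rewrite -DE -[LHS]/(ocomp h _ A D) hE -[LHS]/(ker_val g A (t 1 A D)) -gE.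
rewrite -[LHS]/(g' A (cover_aug (syzygy F 1) A (t 1 A D))).
congr (g' A _); apply: val_inj; rewrite [RHS]xE.
rewrite -[LHS]/(ocomp (free_diff F 0) (t 1) A D) (ft.2 0).
rewrite -[LHS]/(t 0 A (ker_val (cover_aug (syzygy S 1) A D))) DE.
rewrite -[LHS]/(t 0 A (ores u (obase B) - ores v (obase C))) [LHS](raddfB (t 0 A)).
by congr (_ - _); apply/esym/mor_natural.
Qed.
End Duality.

(* [F] is a skyscraper at [Q], with value k through [ev], and [co] is the reduction of
   [G Q] modulo [z Q]. *)
Section Point.
Variables (k : fieldType) (O : ring_sheaf k) (F G : omod O).
Local Notation S := (structure_sheaf O).
Variables (pi : omor S F) (z : forall P, O P) (Q : obj).
Variables (ev : F Q -> k) (co : G Q -> k).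
Hypotheses (pi_epi : oepi pi) (pi_ker : forall P a, pi P a = 0 <-> exists t, a = t * z P).
Hypothesis z_reg : forall P t, t * z P = 0 -> t = 0.
Hypothesis z_unit : forall A B (h : arrow A B), exists v, v * rres O h (z B) = 1.
Hypothesis z1 : forall P, P <> Q -> z P = 1.
Hypothesis F0 : forall P, P <> Q -> forall x : F P, x = 0.
Hypothesis srcQ : forall A B, arrow A B -> A <> Q.
Hypothesis ev_lin : forall c x y, ev (c%:A *: x + y) = c * ev x + ev y.
Hypothesis ev_inj : forall x, ev x = 0 -> x = 0.
Hypothesis ev1 : ev (pi Q 1) = 1.
Hypothesis co_lin : forall c x y, co (c%:A *: x + y) = c * co x + co y.
Hypothesis coP : forall w, co w = 0 <-> exists n, w = z Q *: n.
Hypothesis co1 : exists w, co w = 1.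
Hypothesis G_reg : forall w : G Q, z Q *: w = 0 -> w = 0.

Definition pbase P : Defs.cover F P := projT1 (cid (@cover_aug_epi _ _ F P (pi P 1))).

Lemma pbaseE P : cover_aug F P (pbase P) = pi P 1.
Proof. by rewrite /pbase; case: cid. Qed.

Local Notation zb := (zbase pi_ker pbaseE).

Lemma point_syzygy_projective : projective (syzygy F 1).
Proof. exact: (oker_projective_unit (@cover_projective _ _ F) pi_epi pi_ker pbaseE). Qed.

Lemma evB x y : ev (x - y) = ev x - ev y.
Proof. by have := ev_lin (- 1) y x; rewrite !scaleN1r mulN1r addrC => ->; rewrite addrC. Qed.

Lemma evZ c x : ev (c%:A *: x) = c * ev x.
Proof.
have ev0 : ev 0 = 0 by rewrite -[X in ev X](subrr 0) evB subrr.
by have := ev_lin c x 0; rewrite ev0 !addr0.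
Qed.

(** A morphism from the structure sheaf is determined by the image of 1, and only its value at [Q]
    can be nonzero. *)
Lemma point_coh0 : exists2 al : {linear coh F 0 -> k^o}, bijective al &
  forall f, al (ext_class f) = ev (ker_val f Q (obase Q)).
Proof.
pose l (f : cocycle S F 0) : k^o := ev (ker_val f Q (obase Q)).
have ll : linear l by move=> c f g; exact: ev_lin.
pose l' : {linear cocycle S F 0 -> k^o} := HB.pack l (GRing.isLinear.Build _ _ _ _ _ ll).
apply: (Ext_iso (l := l')) => [f|].
  rewrite -ext_class_eq0 ext_class0_eq0; split=> [|f0]; last first.
    by rewrite /= /l f0 -[omor0 _ _ _ _]/(0 : F Q); have := linear0 l'.
  rewrite /= /l; have [f' <-] := cocycle_factor f => /ev_inj f0.
  apply: omorP => P x; rewrite -[LHS]/(f' P (cover_aug S P x)).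
  have [PQ|PQ] := obj_eq_dec P Q; last exact: F0.
  subst P; rewrite structure_morE (_ : f' Q 1 = 0) ?scaler0 //.
  by rewrite -[1](obaseE Q).
have [f fE] := @factor_cocycle _ _ S F 0 pi; exists f.
by rewrite /= /l fE -[ocomp _ _ _ _]/(pi Q (cover_aug S Q (obase Q))) obaseE.
Qed.

Lemma point_coh1 (x : coh F 1) : x = 0.
Proof.
have [f ->] := qclass_surj x; have [f' ff'] := cocycle_factor f.
apply/ext_class_eq0/(coboundaryP ff')/cech_extend.
exists 0, 0, 0; split.
  by rewrite [LHS](F0 (srcQ A1B1)) [RHS](F0 (srcQ A1B1)).
by rewrite [LHS](F0 (srcQ A2B2)) [RHS](F0 (srcQ A2B2)).
Qed.

(** At [Q] the module [F] is generated by [pi 1], which [z Q] kills, whereas [z Q] is injective on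
    [G Q]. *)
Lemma point_ext0 (x : Ext F G 0) : x = 0.
Proof.
have [f ->] := qclass_surj x; have [f' ff'] := cocycle_factor f.
apply/ext_class0_eq0; rewrite -ff'; apply: omorP => P y.
rewrite -[LHS]/(f' P (cover_aug F P y)) -[RHS]/(0 : G P); move: (cover_aug F P y) => {}y.
have [PQ|PQ] := obj_eq_dec P Q; last by rewrite [y]F0 // linear0.
subst P; have [a <-] := pi_epi y.
rewrite structure_morE linearZ /= (_ : f' Q (pi Q 1) = 0) ?scaler0 //.
apply: G_reg; rewrite -linearZ -structure_morE.
by rewrite (_ : pi Q (z Q) = 0) ?linear0 //; apply/pi_ker; exists 1; rewrite mul1r.
Qed.

(** By [oker_extend_unit] the only obstruction to extending is divisibility of the value at [zbase]
    by [z]. Away from [Q] one has [z = 1], so the class is the value at [Q] modulo [z Q]. *)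
Lemma point_ext1 : exists2 ga : {linear Ext F G 1 -> k^o}, bijective ga &
  forall (g : cocycle F G 1) g', ocomp g' (cover_aug (syzygy F 1)) = ker_val g ->
  ga (ext_class g) = co (g' Q (zb Q)).
Proof.
have [D DE] := @cover_aug_epi _ _ (syzygy F 1) Q (zb Q).
pose l (g : cocycle F G 1) : k^o := co (ker_val g Q D).
have lE (g : cocycle F G 1) g' : ocomp g' (cover_aug (syzygy F 1)) = ker_val g ->
    l g = co (g' Q (zb Q)) by move=> gg'; rewrite /l -gg' -DE.
have ll : linear l by move=> c f g; exact: co_lin.
pose l' : {linear cocycle F G 1 -> k^o} := HB.pack l (GRing.isLinear.Build _ _ _ _ _ ll).
have [||ga ga_bij gaE] := Ext_iso (l := l').
- move=> f; have [f' ff'] := cocycle_factor f.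
  rewrite (coboundaryP ff') [l' f](lE _ _ ff'); split=> [/coP fz|[g <-]].
    apply: (oker_extend_unit (@cover_projective _ _ F) pi_epi z_unit
             (pi_ker := pi_ker) (baseE := pbaseE)) => P.
    have [PQ|PQ] := obj_eq_dec P Q; first by subst P.
    by exists (f' P (zb P)); rewrite z1 // scale1r.
  by apply/coP; exists (g Q (pbase Q)); rewrite /= linearZ.
- have [w w1] := co1.
  pose zeta P : G P := if obj_eq_dec Q P is left e then
    match e in _ = P return G P with erefl => w end else 0.
  have zetaQ : zeta Q = w.
    by rewrite /zeta; case: obj_eq_dec => // e; rewrite (Prop_irrelevance e erefl).
  have [|//|f' _ /(_ Q)[s fQ]] := @oker_lift_unit _ _ _ _ _ pi z pbase (@cover_projective _ _ F)
    pi_epi pi_ker pbaseE z_reg z_unit G (ozero O) 0 0 zeta.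
    by move=> P y; exists 0; apply/matrixP => i [].
  have [f fE] := @factor_cocycle _ _ F G 1 f'; exists f.
  rewrite [l' f](lE _ _ (esym fE)) fQ zetaQ.
  have /(_ (- 1) (z Q *: s) w) := co_lin.
  rewrite !scaleN1r addrC => ->.
  by rewrite (_ : co (z Q *: s) = 0) ?mulr0 ?add0r //; apply/coP; exists s.
by exists ga => // f f' ff'; rewrite gaE; apply: lE.
Qed.

Section Yoneda.
Variables (f : cocycle S F 0) (g : cocycle F G 1).
Variables (t : forall n, omor (rterm (free_resolution S) (n + 0)) (rterm (free_resolution F) n)).
Variables (ft : is_lift f t).
Variables (g' : omor (syzygy F 1) G) (h : omor (syzygy S 1) G).
Hypothesis gE : ocomp g' (cover_aug (syzygy F 1)) = ker_val g.
Hypothesis hE : ocomp h (cover_aug (syzygy S 1)) = ker_val (yoneda_cocycle g ft).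

Lemma lift_ker B : B <> Q -> exists x : syzygy F 1 B, ker_val x = t 0 B (obase B).
Proof.
move=> BQ; have xk : t 0 B (obase B) \in in_ker (cover_aug F B).
  by apply/eqP/(F0 BQ).
by exists (Kernel xk).
Qed.

(** At [Q] the lift of 1 reaches the kernel only after subtracting the multiple of [pbase] with the
    same image in [F]. *)
Lemma lift_ker_point : exists x : syzygy F 1 Q,
  ker_val x = t 0 Q (obase Q) - (ev (ker_val f Q (obase Q)))%:A *: pbase Q.
Proof.
set a := ev _.
have xk : t 0 Q (obase Q) - a%:A *: pbase Q \in in_ker (cover_aug F Q).
  rewrite in_kerE; apply/eqP/ev_inj.
  have E : cover_aug F Q (t 0 Q (obase Q) - a%:A *: pbase Q) =
            ker_val f Q (obase Q) - a%:A *: pi Q 1.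
    rewrite -pbaseE -linearZ [LHS](linearB (cover_aug F Q)); congr (_ - _).
    exact: (omorE ft.1).
  by apply: etrans (congr1 ev E) _; rewrite evB evZ ev1 mulr1 subrr.
by exists (Kernel xk).
Qed.

Lemma yoneda_away A B C (u : arrow A B) (v : arrow A C) (x : syzygy F 1 B) (y : syzygy F 1 C) :
  ker_val x = t 0 B (obase B) -> ker_val y = t 0 C (obase C) ->
  h A (cech u v) = ores u (g' B x) - ores v (g' C y).
Proof.
move=> xE yE.
rewrite (yoneda_cech (x := ores u x - ores v y) gE hE) ?raddfB /= ?mor_natural //.
by rewrite /= xE yE.
Qed.

(** Once restricted to [A], [pbase Q] is [w] times the restriction of [zbase], hence lies in the
    syzygy. Its multiple subtracted in [lift_ker_point] thus yields the main term; the rest has the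
    shape of a boundary. *)
Lemma yoneda_point A C (u : arrow A Q) (v : arrow A C) (w : O A)
    (x : syzygy F 1 Q) (y : syzygy F 1 C) :
  w * rres O u (z Q) = 1 ->
  ker_val x = t 0 Q (obase Q) - (ev (ker_val f Q (obase Q)))%:A *: pbase Q ->
  ker_val y = t 0 C (obase C) ->
  h A (cech u v) = (ev (ker_val f Q (obase Q)))%:A *: (w *: ores u (g' Q (zb Q))) +
    (ores u (g' Q x) - ores v (g' C y)).
Proof.
move=> wz xE yE; set a := ev _ in xE *.
rewrite (yoneda_cech (x := a%:A *: (w *: ores u (zb Q)) + (ores u x - ores v y)) gE hE).
  rewrite (linearD (g' A)) (linearB (g' A)) linearZ /= linearZ /=.
  by rewrite !mor_natural.
have oB a1 a2 : ores u (a1 - a2) = ores u a1 - ores u a2 by rewrite raddfB.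
rewrite -[LHS]/(a%:A *: (w *: ores u (z Q *: pbase Q)) +
                (ores u (ker_val x) - ores v (ker_val y))).
rewrite xE yE oB !ores_semilinear [w *: _]scalerA wz scale1r rmorph_alg.
by rewrite addrA [X in X - _]addrC subrK.
Qed.
End Yoneda.
End Point.

Section ResidueField.
Variable k : fieldType.

Definition ky_class (p : {poly k}) : k_y k := qclass (principal ('X : {poly k})) p.

Lemma ky_class_eq0 p : ky_class p = 0 <-> exists t, p = t * 'X.
Proof.
rewrite /ky_class -[0](raddf0 (qclass (principal ('X : {poly k})))) qclassP subr0.
by split=> [/asboolP[t ->]|[t ->]]; [exists t|apply/asboolP; exists t]; rewrite mulrC.
Qed.

Lemma coef0_eq0 (p : {poly k}) : p`_0 = 0 <-> exists t, p = t * 'X.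
Proof.
split=> [p0|[t ->]]; last by rewrite coefMX.
have /factor_theorem[t] : root p 0 by rewrite rootE horner_coef0 p0.
by rewrite subr0; exists t.
Qed.

(** Evaluation at [y = 0] on a chosen representative; [ky_evE] gives independence of the choice. *)
Definition ky_ev (x : k_y k) : k := (projT1 (cid (qclass_surj x)))`_0.

Lemma ky_evE p : ky_ev (ky_class p) = p`_0.
Proof.
rewrite /ky_ev; case: cid => q /= pq; apply/eqP; rewrite -subr_eq0 -coefB.
apply/eqP/coef0_eq0/ky_class_eq0; rewrite /ky_class raddfB /= -pq.
exact: subrr.
Qed.

Lemma ky_ev_linear (c : k) (x y : k_y k) : ky_ev (c%:A *: x + y) = c * ky_ev x + ky_ev y.
Proof.
have [[p ->] [q ->]] := (qclass_surj x, qclass_surj y).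
rewrite -[LHS]/(ky_ev (c%:A *: ky_class p + ky_class q)) !ky_evE.
have -> : c%:A *: ky_class p + ky_class q = ky_class (c%:A * p + q).
  by rewrite /ky_class -[c%:A * p]/(c%:A *: (p : {poly k}^o)) linearP.
by rewrite ky_evE coefD mulr_algl coefZ.
Qed.

Lemma ky_ev_inj (x : k_y k) : ky_ev x = 0 -> x = 0.
Proof.
have [p ->] := qclass_surj x.
by rewrite -/(ky_class p) ky_evE coef0_eq0 ky_class_eq0.
Qed.
End ResidueField.

(** * The skyscrapers at B1 and B2 *)

Section Sky.
Variables (k : fieldType) (r : nat).
Hypothesis r_gt0 : (0 < r)%N.
Local Notation O := (Okr k r).
Local Notation omega := (omega_kr k r).
Local Notation S := (structure_sheaf O).
Local Notation X := ('X : {poly k}).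

Definition const_coef (w : {poly k}) : k := w`_0.

Lemma const_coef_linear (c : k) (p q : {poly k}) : const_coef (c%:A * p + q) = c * const_coef p + const_coef q.
Proof. by rewrite /const_coef coefD mulr_algl coefZ. Qed.

Lemma const_coefP (p : {poly k}) : const_coef p = 0 <-> exists n, p = X * n.
Proof. by rewrite coef0_eq0; split=> [[t ->]|[t ->]]; exists t; rewrite mulrC. Qed.

Lemma X_reg (w : {poly k}) : X * w = 0 -> w = 0.
Proof. by move/eqP; rewrite mulf_eq0 polyX_eq0 /= => /eqP. Qed.

(** The inverse [x] of the restricted [y] raises the twist [r - 2] to [r - 1], the residue exponent,
    where only [w(0)] contributes. *)
Lemma residue_point (a : k) (w : {poly k}) :
  lcoef r.-1 (a%:A * (lX k 1 * (poly_eval (lX k (- 1)) w * lX k (r%:Z - 2)))) = a * const_coef w.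
Proof.
have -> : lX k 1 * (poly_eval (lX k (- 1)) w * lX k (r%:Z - 2)) =
          poly_eval (lX k (- 1)) w * lX k r.-1%:Z.
  by rewrite mulrCA -lXD; congr (_ * lX k _); lia.
rewrite mulr_algl linearZ /= lcoef_poly_eval // eqxx.
by [].
Qed.

Lemma residue_bdry_l (a b1 b2 : laurent k) : is_bdry r b1 b2 -> residue r (a + b1) b2 = lcoef r.-1 a.
Proof.
move=> /(bdryP r_gt0) b0; rewrite -[b2]add0r residueD b0 // addr0.
by rewrite /residue raddf0 subr0.
Qed.

Lemma residue_bdry_r (a b1 b2 : laurent k) : is_bdry r b1 b2 -> residue r b1 (a + b2) = - lcoef r.-1 a.
Proof.
move=> /(bdryP r_gt0) b0; rewrite -[b1]add0r residueD b0 // addr0.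
by rewrite /residue raddf0 sub0r.
Qed.

Lemma res_X_unit : lX k 1 * poly_eval (lX k (- 1)) X = 1.
Proof. by rewrite -[X]expr1 lX_poly_eval lXV. Qed.

Lemma rV0_eq (R : nzRingType) (x y : 'rV[R]_0) : x = y.
Proof. by apply/matrixP => i []. Qed.

Definition sky1_z P : O P := match P with B1 => X | _ => 1 end.

Definition sky1_pi_fun P : S P -> sky1 (O := O) (k_y k) P :=
  match P return S P -> sky1 (O := O) (k_y k) P with
  | B1 => fun a => ky_class a | _ => fun=> 0 end.

Lemma sky1_pi_linear P : linear (@sky1_pi_fun P).
Proof. by case: P => a x y /=; rewrite ?scaler0 ?addr0 // [LHS]linearP. Qed.

Lemma sky1_pi_natural A B (h : arrow A B) m :
  ores h (@sky1_pi_fun B m) = @sky1_pi_fun A (ores h m).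
Proof. by case: h m. Qed.

Definition sky1_pi : omor S (sky1 (O := O) (k_y k)) := OMor sky1_pi_linear sky1_pi_natural.

Lemma sky1_pi_epi : oepi sky1_pi.
Proof.
case=> y; try by exists 0; apply: rV0_eq.
by have [p ->] := qclass_surj y; exists p.
Qed.

Lemma sky1_pi_ker P a : sky1_pi P a = 0 <-> exists t, a = t * sky1_z P.
Proof.
case: P a => a; rewrite /= ?ky_class_eq0 //;
  by split=> [_|_]; [exists a; rewrite mulr1|apply: rV0_eq].
Qed.

Lemma sky1_z_reg P (t : O P) : t * sky1_z P = 0 -> t = 0.
Proof.
case: P t => t /=; rewrite ?mulr1 //.
by rewrite mulrC; apply: X_reg.
Qed.

Lemma sky1_z_unit A B (h : arrow A B) : exists v, v * rres O h (sky1_z B) = 1.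
Proof.
case: h; [exists (lX k 1); exact: res_X_unit|..];
  by exists 1; rewrite mul1r /sky1_z rmorph1.
Qed.

Lemma sky1_z1 P : P <> B1 -> sky1_z P = 1.
Proof. by case: P. Qed.

Lemma sky1_0 P : P <> B1 -> forall x : sky1 (O := O) (k_y k) P, x = 0.
Proof. by case: P => // _ x; apply: rV0_eq. Qed.

Lemma srcB1 A B : arrow A B -> A <> B1.
Proof. by case. Qed.

Lemma sky1_ev1 : ky_ev (sky1_pi B1 1) = 1.
Proof. by rewrite [LHS]ky_evE coef1. Qed.

Lemma sky1_duality (phi : {linear coh omega 1 -> k^o}) : bijective phi ->
  strong_duality phi (sky1 (O := O) (k_y k)).
Proof.
move=> phi_bij; have [phi0 phi0_bij phi0E] := coh_omega k r_gt0.
have [al al_bij alE] := point_coh0 sky1_0 (@ky_ev_linear k) (@ky_ev_inj k) sky1_ev1.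
have co1 : exists w, const_coef w = 1 by exists 1; rewrite /const_coef coef1.
have [ga ga_bij gaE] := point_ext1 (G := omega) sky1_pi_epi sky1_pi_ker sky1_z_reg sky1_z_unit
  sky1_z1 const_coef_linear const_coefP co1.
apply: (strong_duality_of phi_bij phi0_bij al_bij ga_bij (oner_neq0 k)).
- move=> f g t ft; rewrite alE.
  have [g' gE] := cocycle_factor g; rewrite (gaE _ _ gE).
  have [h hE] := cocycle_factor (yoneda_cocycle g ft); rewrite (phi0E _ _ hE).
  have [x1 x1E] := lift_ker_point (F := sky1 (O := O) (k_y k)) (Q := B1)
    (@ky_ev_linear k) (@ky_ev_inj k) sky1_ev1 ft.
  have [x2 x2E] := lift_ker sky1_0 t (B := B2) (fun e => ltac:(discriminate e)).
  have [x3 x3E] := lift_ker sky1_0 t (B := B3) (fun e => ltac:(discriminate e)).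
  rewrite (yoneda_point sky1_pi_ker gE hE A1B3 (u := A1B1) res_X_unit x1E x3E).
  rewrite (yoneda_away gE hE A2B2 A2B3 x2E x3E).
  pose w := g' B1 (zbase sky1_pi_ker (pbaseE sky1_pi) B1).
  pose a := ky_ev (ker_val f B1 (obase B1)).
  (* On A1 the product is the main term plus a boundary component, and on A2 it is the other
     component of the same boundary. *)
  apply: etrans (@residue_bdry_l (a%:A * (lX k 1 * (poly_eval (lX k (- 1)) w * lX k (r%:Z - 2))))
    _ _ _) _.
    by exists (g' B1 x1), (g' B2 x2), (g' B3 x3).
  by apply: etrans (residue_point _ _) _; rewrite mul1r.
- exact: (point_coh1 sky1_0 srcB1).
- exact: (point_ext0 (G := omega) sky1_pi_epi sky1_pi_ker sky1_0 X_reg).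
exact: (point_syzygy_projective sky1_pi_epi sky1_pi_ker sky1_z_reg sky1_z_unit).
Qed.
Definition sky2_z P : O P := match P with B2 => X | _ => 1 end.

Definition sky2_pi_fun P : S P -> sky2 (O := O) (k_y k) P :=
  match P return S P -> sky2 (O := O) (k_y k) P with
  | B2 => fun a => ky_class a | _ => fun=> 0 end.

Lemma sky2_pi_linear P : linear (@sky2_pi_fun P).
Proof. by case: P => a x y /=; rewrite ?scaler0 ?addr0 // [LHS]linearP. Qed.

Lemma sky2_pi_natural A B (h : arrow A B) m :
  ores h (@sky2_pi_fun B m) = @sky2_pi_fun A (ores h m).
Proof. by case: h m. Qed.

Definition sky2_pi : omor S (sky2 (O := O) (k_y k)) := OMor sky2_pi_linear sky2_pi_natural.

Lemma sky2_pi_epi : oepi sky2_pi.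
Proof.
case=> y; try by exists 0; apply: rV0_eq.
by have [p ->] := qclass_surj y; exists p.
Qed.

Lemma sky2_pi_ker P a : sky2_pi P a = 0 <-> exists t, a = t * sky2_z P.
Proof.
case: P a => a; rewrite /= ?ky_class_eq0 //;
  by split=> [_|_]; [exists a; rewrite mulr1|apply: rV0_eq].
Qed.

Lemma sky2_z_reg P (t : O P) : t * sky2_z P = 0 -> t = 0.
Proof.
case: P t => t /=; rewrite ?mulr1 //.
by rewrite mulrC; apply: X_reg.
Qed.

Lemma sky2_z_unit A B (h : arrow A B) : exists v, v * rres O h (sky2_z B) = 1.
Proof.
case: h; [|exists (lX k 1); exact: res_X_unit|..];
  by exists 1; rewrite mul1r /sky2_z rmorph1.
Qed.

Lemma sky2_z1 P : P <> B2 -> sky2_z P = 1.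
Proof. by case: P. Qed.

Lemma sky2_0 P : P <> B2 -> forall x : sky2 (O := O) (k_y k) P, x = 0.
Proof. by case: P => // _ x; apply: rV0_eq. Qed.

Lemma srcB2 A B : arrow A B -> A <> B2.
Proof. by case. Qed.

Lemma sky2_ev1 : ky_ev (sky2_pi B2 1) = 1.
Proof. by rewrite [LHS]ky_evE coef1. Qed.

Lemma sky2_duality (phi : {linear coh omega 1 -> k^o}) : bijective phi ->
  strong_duality phi (sky2 (O := O) (k_y k)).
Proof.
move=> phi_bij; have [phi0 phi0_bij phi0E] := coh_omega k r_gt0.
have [al al_bij alE] := point_coh0 sky2_0 (@ky_ev_linear k) (@ky_ev_inj k) sky2_ev1.
have co1 : exists w, const_coef w = 1 by exists 1; rewrite /const_coef coef1.
have [ga ga_bij gaE] := point_ext1 (G := omega) sky2_pi_epi sky2_pi_ker sky2_z_reg sky2_z_unit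
  sky2_z1 const_coef_linear const_coefP co1.
(* The main term now lies on A2, which the residue counts with a minus sign. *)
apply: (strong_duality_of phi_bij phi0_bij al_bij ga_bij (e := - 1)).
- by rewrite oppr_eq0 oner_neq0.
- move=> f g t ft; rewrite alE.
  have [g' gE] := cocycle_factor g; rewrite (gaE _ _ gE).
  have [h hE] := cocycle_factor (yoneda_cocycle g ft); rewrite (phi0E _ _ hE).
  have [x1 x1E] := lift_ker_point (F := sky2 (O := O) (k_y k)) (Q := B2)
    (@ky_ev_linear k) (@ky_ev_inj k) sky2_ev1 ft.
  have [x2 x2E] := lift_ker sky2_0 t (B := B1) (fun e => ltac:(discriminate e)).
  have [x3 x3E] := lift_ker sky2_0 t (B := B3) (fun e => ltac:(discriminate e)).
  rewrite (yoneda_point sky2_pi_ker gE hE A2B3 (u := A2B2) res_X_unit x1E x3E).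
  rewrite (yoneda_away gE hE A1B1 A1B3 x2E x3E).
  pose w := g' B2 (zbase sky2_pi_ker (pbaseE sky2_pi) B2).
  pose a := ky_ev (ker_val f B2 (obase B2)).
  apply: etrans (@residue_bdry_r (a%:A * (lX k 1 * (poly_eval (lX k (- 1)) w * lX k (r%:Z - 2))))
    _ _ _) _.
    by exists (g' B1 x2), (g' B2 x1), (g' B3 x3).
  by rewrite mulN1r mulNr; congr (- _); apply: residue_point.
- exact: (point_coh1 sky2_0 srcB2).
- exact: (point_ext0 (G := omega) sky2_pi_epi sky2_pi_ker sky2_0 X_reg).
exact: (point_syzygy_projective sky2_pi_epi sky2_pi_ker sky2_z_reg sky2_z_unit).
Qed.
End Sky.

Theorem theorem12p2 (k : fieldType) (r : nat) (r_ge1 : (1 <= r)%N) :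
  (exists phi : {linear coh (omega_kr k r) 1 -> k^o}, bijective phi) /\
  forall phi : {linear coh (omega_kr k r) 1 -> k^o}, bijective phi ->
    strong_duality phi (sky1 (O := Okr k r) (k_y k)) /\
    strong_duality phi (sky2 (O := Okr k r) (k_y k)).
Proof.
split=> [|phi phi_bij]; last by split; [exact: sky1_duality|exact: sky2_duality].
by have [phi phi_bij _] := coh_omega k r_ge1; exists phi.
Qed.
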